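(* Let $S(z)\in\mathcal L(\mathcal E,\mathcal E_* )[[z]]$ be in the Schur–Agler class $\mathcal{SA}(\mathcal E,\mathcal E_* )$ and let $K_1(z,w),\dots,K_d(z,w)$ be an augmented Agler decomposition for $S$. Let $\mathcal D,\mathcal R,V,\mathcal L,\mathcal L',U_0=[U_{0,ij}]_{i,j=1}^3$ be as defined in the context. Then: (1) Any GR-unitary colligation which gives a realization of $S$ compatible with the given augmented Agler decomposition is unitarily equivalent to a unitary extension $$U=\begin{bmatrix}A_{11}&A_{12}&B_1\\ A_{21}&A_{22}&B_2\\ C_1&C_2&D\end{bmatrix}:\begin{bmatrix}\widehat\bigoplus_{k=1}^d\mathcal H(K_k)\\ \widehat\bigoplus_{k=1}^d\widetilde{\mathcal H}_k\\ \mathcal E\end{bmatrix}\to\begin{bmatrix}\widehat\bigoplus_{k=1}^d\mathcal H(K_k)\\ \widehat\bigoplus_{k=1}^d\widetilde{\mathcal H}_k\\ \mathcal E_*\end{bmatrix}$$ (for some Hilbert spaces $\widetilde{\mathcal H}_1,\dots,\widetilde{\mathcal H}_d$) of the partially defined unitary operator $V:\mathcal D\to\mathcal R$. (2) Such unitary extensions $U$ are parametrized by GR-unitary colligations $$\widetilde U=\begin{bmatrix}\widetilde U_{11}&\widetilde U_{12}\\ \widetilde U_{21}&\widetilde U_{22}\end{bmatrix}:\begin{bmatrix}\widehat\bigoplus_{k=1}^d\widetilde{\mathcal H}_k\\ \mathcal L\end{bmatrix}\to\begin{bmatrix}\widehat\bigoplus_{k=1}^d\widetilde{\mathcal H}_k\\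 \mathcal L'\end{bmatrix}$$ via the feedback connection: $U(\widehat\bigoplus h_k,\widehat\bigoplus\widetilde h_k,e)=(\widehat\bigoplus h_k',\widehat\bigoplus\widetilde h_k',e_* )$ means that there are uniquely determined vectors $\ell\in\mathcal L$, $\ell'\in\mathcal L'$ such that $$U_0(\widehat\bigoplus h_k,\,e,\,\ell')=(\widehat\bigoplus h_k',\,e_*,\,\ell),\qquad\widetilde U(\widehat\bigoplus\widetilde h_k,\,\ell)=(\widehat\bigoplus\widetilde h_k',\,\ell').$$ Explicitly, $$U=\begin{bmatrix}U_{0,11}+U_{0,13}\widetilde U_{22}U_{0,31}&U_{0,13}\widetilde U_{21}&U_{0,12}+U_{0,13}\widetilde U_{22}U_{0,32}\\ \widetilde U_{12}U_{0,31}&\widetilde U_{11}&\widetilde U_{12}U_{0,32}\\ U_{0,21}+U_{0,23}\widetilde U_{22}U_{0,31}&U_{0,23}\widetilde U_{21}&U_{0,22}+U_{0,23}\widetilde U_{22}U_{0,32}\end{bmatrix}.$$ (3) The colligation $\widetilde U$ is closely connected if and only if there is no nonzero reducing subspace of $U$ (that is, a subspace that $U$ maps onto itself) contained in $\widetilde{\mathcal H}=\widehat\bigoplus_{k=1}^d\widetilde{\mathcal H}_k$ and invariant under the projections $P_k$, $k=1,\dots,d$. (4) $\widetilde U$ is unitarily equivalent to $\widetilde U'$ (as colligations) if and only if the corresponding $U$ is unitarily equivalent to $U'$ (as colligations) by a unitary equivalence which is the identity on $\widehat\bigoplus_{k=1}^d\mathcal H(K_k)$.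
   Context: **Formal series and kernels.** For a Hilbert space $\mathcal G$, $\mathcal G[[z^{\pm1}]]$ is the space of formal Laurent series $\sum_{n\in\mathbb Z^d}f_nz^n$ in commuting indeterminates $z_1,\dots,z_d$ with arbitrary support. Convention: $(z^n)^*=z^{-n}$, $H(z)^*=\sum H_n^*z^{-n}$. A kernel $K(z,w)=\sum K_{n,m}z^nw^{-m}\in\mathcal L(\mathcal G)[[z^{\pm1},w^{\pm1}]]$ is positive if $\sum\langle K_{n,m}u_m,u_n\rangle\ge0$ for finitely supported $(u_n)$; equivalently $K=H(z)H(w)^*$. $\mathcal H(K)$ is the unique Hilbert space of formal series in $\mathcal G[[z^{\pm1}]]$ containing all $[K]_m(z)u:=\sum_nK_{n,m}u\,z^n$ with $\langle f,[K]_mu\rangle=\langle f_m,u\rangle$. For positive kernels $K_1,\dots,K_d$ the overlapping space $\mathcal L(K_1,\dots,K_d)$ is the kernel of the sum map $\widehat\bigoplus f_k\mapsto\sum f_k$ on the external direct sum $\widehat\bigoplus_k\mathcal H(K_k)$. **Schur–Agler class and augmented Agler decomposition.** $\mathcal{SA}(\mathcal E,\mathcal E_* )$ is the class of holomorphic $\mathcal L(\mathcal E,\mathcal E_* )$-valued $S$ on $\mathbb D^d$, identified with $S(z)=\sum_{n\in\mathbb Z^d_+}S_nz^n$ ($S_n=0$ for $n\notin\mathbb Z^d_+$), such that $\|\sum S_n\otimes T^n\|\le1$ for every commuting $d$-tuple $T$ of strict contractions on a Hilbert space. An augmented Agler decomposition of $S$ is a collection of positive kernels $K_k(z,w)=H_k(z)H_k(w)^*$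 with coefficients in $\mathcal L(\mathcal E_*\oplus\mathcal E)$, $H_k=\begin{bmatrix}H_k^1\\ H_k^2\end{bmatrix}$, $H_k^1$ supported in $\mathbb Z^d_+$, $H_k^2$ supported in $-\mathbf e_k-\mathbb Z_+^d$ ($\mathbf e_k$ the standard basis vectors), such that $$\begin{bmatrix}I-S(z)S(w)^*&S(w)-S(z)\\ S(z)^*-S(w)^*&S(z)^*S(w)-I\end{bmatrix}=\sum_{k=1}^d(1-z_kw_k^{-1})K_k(z,w).$$ **GR-unitary colligations.** A GR-unitary colligation with input space $\mathcal E$ and output space $\mathcal E_*$ is a unitary $U=\begin{bmatrix}A&B\\ C&D\end{bmatrix}:\mathcal H\oplus\mathcal E\to\mathcal H\oplus\mathcal E_*$ with a decomposition $\mathcal H=\bigoplus_{k=1}^d\mathcal H_k$; $P_k$ is the projection onto $\mathcal H_k$ and $Z(z)=\sum z_kP_k$. It realizes $S$ if $S(z)=D+C(I-Z(z)A)^{-1}Z(z)B$. It is compatible with $\{K_k\}$ if $$K_k(z,w)=\begin{bmatrix}C(I-Z(z)A)^{-1}\\ z_k^{-1}B^*(I-Z(z)^{-1}A^* )^{-1}\end{bmatrix}P_k\begin{bmatrix}(I-A^*Z(w)^{-1})^{-1}C^*&(I-AZ(w))^{-1}Bw_k\end{bmatrix}.$$ Two colligations $(A,B,C,D,P_k)$, $(A',B',C',D',P'_k)$ with the same input and output spaces are unitarily equivalent if there is a unitary $\tau:\mathcal H\to\mathcal H'$ with $\tau P_k=P_k'\tau$ for all $k$ and $U'(\tau\oplus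 I)=(\tau\oplus I)U$. A colligation is closely connected if $\mathcal H$ is the smallest (closed) subspace containing $\operatorname{im}B$ and $\operatorname{im}C^*$ and invariant under $A,A^*,P_1,\dots,P_d$. For $U$ acting as in (1), the state space is $\widehat\bigoplus_k(\mathcal H(K_k)\widehat\oplus\widetilde{\mathcal H}_k)$ and $P_k$ is the projection onto $\mathcal H(K_k)\widehat\oplus\widetilde{\mathcal H}_k$. **The operators $V$ and $U_0$.** Let $K'_k(z,w)=z_kK_k(z,w)w_k^{-1}$, $\mathcal L=\mathcal L(K_1,\dots,K_d)$, $\mathcal L'=\mathcal L(K'_1,\dots,K'_d)$. Let $$\mathcal D=\overline{\operatorname{span}}\left\{\begin{bmatrix}[K_1]_m(z)\binom{e_*}{e}\\ \vdots\\ [K_d]_m(z)\binom{e_*}{e}\\ S_m^*e_*+\delta_{m,0}e\end{bmatrix}\right\}\subset\widehat\bigoplus_k\mathcal H(K_k)\widehat\oplus\mathcal E,\quad\mathcal R=\overline{\operatorname{span}}\left\{\begin{bmatrix}[K_1]_{m-\mathbf e_1}(z)\binom{e_*}{e}\\ \vdots\\ [K_d]_{m-\mathbf e_d}(z)\binom{e_*}{e}\\ \delta_{m,0}e_*+S_{-m}e\end{bmatrix}\right\}\subset\widehat\bigoplus_k\mathcal H(K_k)\widehat\oplus\mathcal E_*,$$ with $e_*\in\mathcal E_*$, $e\in\mathcal E$, $m\in\mathbb Z^d$. Mapping the displayed generator of $\mathcal D$ to that of $\mathcal R$ with the same $m,e_*,e$ extends to a unitary $V:\mathcal D\to\mathcal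 R$. The orthogonal complement of $\mathcal D$ in $\widehat\bigoplus\mathcal H(K_k)\widehat\oplus\mathcal E$ is $\mathcal L\oplus\{0\}$, and that of $\mathcal R$ in $\widehat\bigoplus\mathcal H(K_k)\widehat\oplus\mathcal E_*$ is $\jmath\mathcal L'\oplus\{0\}$, where $\jmath(\widehat\bigoplus f_k)=\widehat\bigoplus z_k^{-1}f_k$ maps $\widehat\bigoplus\mathcal H(K_k')$ unitarily onto $\widehat\bigoplus\mathcal H(K_k)$. $U_0=[U_{0,ij}]_{i,j=1}^3:\widehat\bigoplus\mathcal H(K_k)\widehat\oplus\mathcal E\widehat\oplus\mathcal L'\to\widehat\bigoplus\mathcal H(K_k)\widehat\oplus\mathcal E_*\widehat\oplus\mathcal L$ is the unitary operator with $U_0(\mathbf d,0)=(V\mathbf d,0)$ for $\mathbf d\in\mathcal D$, $U_0(\ell,0,0)=(0,0,\ell)$ for $\ell\in\mathcal L$, $U_0(0,0,\ell')=(\jmath\ell',0,0)$ for $\ell'\in\mathcal L'$ (so $U_{0,33}=0$). *)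

(* Defs.v *)
From HB Require Import structures.
From mathcomp Require Import all_boot all_order all_algebra.
From mathcomp Require Import sesquilinear complex ring.
From mathcomp Require Import boolp classical_sets reals.

Set Implicit Arguments.
Unset Strict Implicit.
Unset Printing Implicit Defensive.

Import Order.TTheory GRing.Theory Num.Theory Num.Def.

Local Open Scope ring_scope.
Local Open Scope complex_scope.
Local Open Scope classical_set_scope.

(* The topology of a Hilbert space is not taken from completeNormedModType: *)
(* the library equips V * W with the sup norm, whereas the direct sum of    *)
(* two Hilbert spaces, whose carrier is V * W, needs the l^2 norm.          *)

Section Norm.
Variables (R : realType) (V : lmodType R[i]) (dot : {dot V for (@conjC R[i])}).

Definition dot_norm (x : V) : R := Num.sqrt (complex.Re (dot x x)).

Definition dot_cvg (u : nat -> V) (l : V) : Prop :=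
  forall eps : R, 0 < eps ->
  exists N, forall n, (N <= n)%N -> dot_norm (u n - l) < eps.

Definition dot_cauchy (u : nat -> V) : Prop :=
  forall eps : R, 0 < eps ->
  exists N, forall m n, (N <= m)%N -> (N <= n)%N -> dot_norm (u m - u n) < eps.

End Norm.

HB.mixin Record isHilbert (R : realType) V of GRing.Lmodule R[i] V := {
  hdot : {dot V for (@conjC R[i])};
  hdot_complete : forall u : nat -> V,
    dot_cauchy hdot u -> exists l : V, dot_cvg hdot u l
}.

#[short(type="hilbertType")]
HB.structure Definition Hilbert (R : realType) :=
  { V of GRing.Lmodule R[i] V & isHilbert R V }.

Notation "''[' u , v ]" := (hdot u v) : ring_scope.

Definition hnorm (R : realType) (V : hilbertType R) (x : V) : R :=
  dot_norm (@hdot R V) x.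

Definition hcvg (R : realType) (V : hilbertType R) (u : nat -> V) (l : V) :=
  dot_cvg (@hdot R V) u l.

Section MakeDot.
Variables (R : realType) (V : lmodType R[i]) (f : V -> V -> R[i]).
Hypothesis f_lin : forall a x y z, f (a *: x + y) z = a * f x z + f y z.
Hypothesis f_herm : forall x y, f x y = conjC (f y x).
Hypothesis f_pos : forall x, x != 0 -> 0 < f x x.

Let f_bilinear : bilinear_for
  (GRing.Scale.Law.clone _ _ *%R _) (GRing.Scale.Law.clone _ _ (conjC \; *%R) _)
  f.
Proof.
split=> [z a x y|z a x y] /=; first exact: f_lin.
by rewrite f_herm f_lin rmorphD rmorphM /= -!f_herm.
Qed.

Definition mk_dot_fun of phantom (V -> V -> R[i]) f := f.
Local Notation g := (mk_dot_fun (Phantom _ f)).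

HB.instance Definition _ := bilinear_isBilinear.Build _ _ _ _ _ _ g f_bilinear.
Let g_herm x y : g x y = (-1) ^+ false * conjC (g y x).
Proof. by rewrite expr0 mul1r; exact: f_herm. Qed.
HB.instance Definition _ :=
  isHermitianSesquilinear.Build _ _ false (@conjC R[i]) g g_herm.
HB.instance Definition _ := isDotProduct.Build _ _ g f_pos.

Definition mk_dot : {dot V for (@conjC R[i])} := g.

Lemma mk_dotE x y : mk_dot x y = f x y. Proof. by []. Qed.
End MakeDot.

Section HilbertTheory.
Variables (R : realType) (V : hilbertType R).
Implicit Types (x y z : V) (a : R[i]).

Lemma hdotDl x y z : '[x + y, z] = '[x, z] + '[y, z].
Proof. exact: linearDl. Qed.

Lemma hdotZl a x z : '[a *: x, z] = a * '[x, z].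
Proof. exact: linearZl_LR. Qed.

Lemma hdotPl a x y z : '[a *: x + y, z] = a * '[x, z] + '[y, z].
Proof. by rewrite hdotDl hdotZl. Qed.

Lemma hdotC x y : '[x, y] = conjC '[y, x].
Proof. by rewrite (@hermC _ false) expr0 mul1r. Qed.

Lemma hdotBl x y z : '[x - y, z] = '[x, z] - '[y, z].
Proof. exact: linearBl. Qed.

Lemma hdotBr x y z : '[x, y - z] = '[x, y] - '[x, z].
Proof. exact: linearBr. Qed.

Lemma hdotZr a x z : '[x, a *: z] = conjC a * '[x, z].
Proof. exact: linearZr_LR. Qed.

Lemma hdot0l x : '[0, x] = 0. Proof. exact: linear0l. Qed.

Lemma hdot_ge0 x : 0 <= '[x, x]. Proof. exact: dnorm_ge0. Qed.

Lemma hdot_gt0 x : x != 0 -> 0 < '[x, x].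
Proof. by rewrite -(dnorm_gt0 (@hdot R V)). Qed.

Lemma hdot_eq0 x : '[x, x] = 0 -> x = 0.
Proof. by move/eqP; rewrite dnorm_eq0 => /eqP. Qed.

Lemma hdot_suml (I : Type) (r : seq I) (P : pred I) (F : I -> V) y :
  '[\sum_(i <- r | P i) F i, y] = \sum_(i <- r | P i) '[F i, y].
Proof. exact: linear_sumlz. Qed.

Definition nsq x : R := complex.Re '[x, x].

Lemma nsqE x : '[x, x] = (nsq x)%:C.
Proof. by have := hdot_ge0 x; rewrite /nsq lecE; case: ('[x, x]) => p q /= /andP[/eqP-> _]. Qed.

Lemma nsq_ge0 x : 0 <= nsq x.
Proof. by have := hdot_ge0 x; rewrite nsqE lecR. Qed.

Lemma hnorm_lt x e : 0 < e -> (hnorm x < e) = (nsq x < e ^+ 2).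
Proof.
move=> e0; rewrite /hnorm /dot_norm -/(nsq x).
by rewrite -[X in _ < X](ger0_norm (ltW e0)) -sqrtr_sqr ltr_sqrt ?exprn_gt0.
Qed.

Lemma nsq_lt x e : 0 < e -> (nsq x < e) = (hnorm x < Num.sqrt e).
Proof. by move=> e0; rewrite hnorm_lt ?sqrtr_gt0 // sqr_sqrtr // ltW. Qed.

Lemma hcvgP (u : nat -> V) l : hcvg u l <->
  forall eps : R, 0 < eps ->
  exists N, forall n, (N <= n)%N -> nsq (u n - l) < eps.
Proof.
split=> H e e0.
  have [|N HN] := H (Num.sqrt e); first by rewrite sqrtr_gt0.
  by exists N => n /HN; rewrite nsq_lt.
have [|N HN] := H (e ^+ 2); first by rewrite exprn_gt0.
by exists N => n /HN; rewrite -hnorm_lt.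
Qed.

Lemma hcauchyP (u : nat -> V) : dot_cauchy (@hdot R V) u <->
  forall eps : R, 0 < eps ->
  exists N, forall m n, (N <= m)%N -> (N <= n)%N -> nsq (u m - u n) < eps.
Proof.
split=> H e e0.
  have [|N HN] := H (Num.sqrt e); first by rewrite sqrtr_gt0.
  by exists N => m n hm hn; rewrite nsq_lt //; exact: HN.
have [|N HN] := H (e ^+ 2); first by rewrite exprn_gt0.
by exists N => m n hm hn; have := HN m n hm hn; rewrite -hnorm_lt.
Qed.

Lemma hcomplete (u : nat -> V) :
  dot_cauchy (@hdot R V) u -> exists l : V, hcvg u l.
Proof. exact: hdot_complete. Qed.

Lemma hdot_CS x y : `|'[x, y]| ^+ 2 <= '[x, x] * '[y, y].
Proof.
have [->|y0] := eqVneq y 0.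
  by rewrite [X in `|X|]hdotC !hdot0l conjC0 normr0 expr0n mulr0.
have yy := hdot_gt0 y0.
have := hdot_ge0 ('[y, y] *: x - '[x, y] *: y).
have cyy : conjC '[y, y] = '[y, y] by rewrite -hdotC.
rewrite hdotBl !hdotBr !hdotZl !hdotZr cyy -[conjC '[x, y]]hdotC.
rewrite normCK -hdotC.
set a := '[x, x]; set b := '[y, y]; set c := '[x, y]; set d := '[y, x].
have -> : b * (b * a) - b * (d * c) - (c * (b * d) - c * (d * b))
  = b * (a * b - c * d) by ring.
by rewrite pmulr_rge0 // subr_ge0.
Qed.

Lemma hcvg_orth (u : nat -> V) l y :
  hcvg u l -> (forall n, '[u n, y] = 0) -> '[l, y] = 0.
Proof.
move=> /hcvgP ul uy; apply/eqP; apply/negP => /negP ly0.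
have [y0|y0] := eqVneq y 0; first by rewrite y0 hdotC hdot0l conjC0 eqxx in ly0.
have yy := hdot_gt0 y0; rewrite nsqE ltcR in yy.
pose p := complex.Re (`|'[l, y]| ^+ 2).
have pE : `|'[l, y]| ^+ 2 = p%:C.
  have : 0 <= `|'[l, y]| ^+ 2 by rewrite exprn_ge0.
  by rewrite /p lecE; case: (_ ^+ 2) => r s /= /andP[/eqP-> _].
have p0 : 0 < p.
  by rewrite -ltcR -pE exprn_gt0 // normr_gt0.
have [|N /(_ N (leqnn N))] := ul (p / nsq y); first by rewrite divr_gt0.
rewrite ltr_pdivlMr // -ltcR rmorphM /= -!nsqE -pE.
have := hdot_CS (u N - l) y; rewrite hdotBl uy sub0r normrN => CS.
by move/(le_lt_trans CS); rewrite ltxx.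
Qed.

End HilbertTheory.

Section Pair.
Variables (R : realType) (V W : hilbertType R).

Let f (x y : V * W) : R[i] := '[x.1, y.1] + '[x.2, y.2].
Let f_lin a x y z : f (a *: x + y) z = a * f x z + f y z.
Proof. by rewrite /f !hdotPl mulrDr addrACA. Qed.
Let f_herm x y : f x y = conjC (f y x).
Proof. by rewrite /f rmorphD /= -!hdotC. Qed.
Let f_pos x : x != 0 -> 0 < f x x.
Proof.
move=> x0; rewrite lt_neqAle addr_ge0 ?hdot_ge0 // andbT eq_sym.
apply: contraNneq x0 => /eqP; rewrite /f paddr_eq0 ?hdot_ge0 //.
move=> /andP[/eqP/hdot_eq0 h1 /eqP/hdot_eq0 h2].
by apply/eqP; rewrite [x]surjective_pairing h1 h2.
Qed.

Definition pair_dot := mk_dot f_lin f_herm f_pos.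

Let pair_complete (u : nat -> V * W) :
  dot_cauchy pair_dot u -> exists l, dot_cvg pair_dot u l.
Proof.
have nE x : dot_norm pair_dot x = Num.sqrt (nsq x.1 + nsq x.2).
  by rewrite /dot_norm mk_dotE /f !nsqE.
move=> cu.
have c1 : dot_cauchy (@hdot R V) (fun n => (u n).1).
  move=> e /cu[N HN]; exists N => m n hm hn; apply: le_lt_trans (HN m n hm hn).
  by rewrite nE ler_sqrt ?addr_ge0 ?nsq_ge0 // lerDl nsq_ge0.
have c2 : dot_cauchy (@hdot R W) (fun n => (u n).2).
  move=> e /cu[N HN]; exists N => m n hm hn; apply: le_lt_trans (HN m n hm hn).
  by rewrite nE ler_sqrt ?addr_ge0 ?nsq_ge0 // lerDr nsq_ge0.
have [l1 /hcvgP h1] := hcomplete c1; have [l2 /hcvgP h2] := hcomplete c2.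
exists (l1, l2) => e e0.
have e20 : 0 < e ^+ 2 / 2 by rewrite divr_gt0 ?exprn_gt0.
have [N1 H1] := h1 _ e20; have [N2 H2] := h2 _ e20.
exists (maxn N1 N2) => n; rewrite geq_max => /andP[n1 n2].
rewrite nE /= -[X in _ < X](ger0_norm (ltW e0)) -sqrtr_sqr ltr_sqrt ?exprn_gt0 //.
by rewrite [X in _ < X]splitr ltrD ?H1 ?H2.
Qed.

HB.instance Definition _ := isHilbert.Build R (V * W)%type pair_complete.
End Pair.

Definition dsum (R : realType) (I : finType) (H : I -> hilbertType R) : Type :=
  forall i, H i.

Section DirectSum.
Variables (R : realType) (I : finType) (H : I -> hilbertType R).
Local Notation D := (dsum H).
Implicit Types x y z : D.

HB.instance Definition _ := gen_eqMixin D.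
HB.instance Definition _ := gen_choiceMixin D.

Let add x y : D := fun i => x i + y i.
Let opp x : D := fun i => - x i.
Let zero : D := fun=> 0.
Let addA : associative add.
Proof. by move=> x y z; apply: functional_extensionality_dep => i; exact: addrA. Qed.
Let addC : commutative add.
Proof. by move=> x y; apply: functional_extensionality_dep => i; exact: addrC. Qed.
Let add0 : left_id zero add.
Proof. by move=> x; apply: functional_extensionality_dep => i; exact: add0r. Qed.
Let addN : left_inverse zero opp add.
Proof. by move=> x; apply: functional_extensionality_dep => i; exact: addNr. Qed.

HB.instance Definition _ := GRing.isZmodule.Build D addA addC add0 addN.

Let scale (a : R[i]) x : D := fun i => a *: x i.
Let scaleA a b x : scale a (scale b x) = scale (a * b) x.
Proof. by apply: functional_extensionality_dep => i; exact: scalerA. Qed.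
Let scale1 : left_id 1 scale.
Proof. by move=> x; apply: functional_extensionality_dep => i; exact: scale1r. Qed.
Let scaleDr : right_distributive scale +%R.
Proof. by move=> a x y; apply: functional_extensionality_dep => i; exact: scalerDr. Qed.
Let scaleDl x : {morph scale^~ x : a b / a + b}.
Proof. by move=> a b; apply: functional_extensionality_dep => i; exact: scalerDl. Qed.

HB.instance Definition _ :=
  GRing.Zmodule_isLmodule.Build R[i] D scaleA scale1 scaleDr scaleDl.

Lemma dsumD x y i : (x + y) i = x i + y i. Proof. by []. Qed.
Lemma dsumN x i : (- x) i = - x i. Proof. by []. Qed.
Lemma dsumZ (a : R[i]) x i : (a *: x) i = a *: x i. Proof. by []. Qed.
Lemma dsum0 i : (0 : D) i = 0. Proof. by []. Qed.

Let f x y : R[i] := \sum_i '[x i, y i].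
Let f_lin a x y z : f (a *: x + y) z = a * f x z + f y z.
Proof. by rewrite /f mulr_sumr -big_split; apply: eq_bigr => i _; rewrite hdotPl. Qed.
Let f_herm x y : f x y = conjC (f y x).
Proof. by rewrite /f rmorph_sum /=; apply: eq_bigr => i _; exact: hdotC. Qed.
Let f_pos x : x != 0 -> 0 < f x x.
Proof.
move=> x0; rewrite lt_neqAle sumr_ge0 => [|i _]; last exact: hdot_ge0.
rewrite andbT eq_sym; apply: contraNneq x0 => /eqP; rewrite /f psumr_eq0.
  move=> /allP h; apply/eqP; apply: functional_extensionality_dep => i.
  by apply: hdot_eq0; apply/eqP; apply: h; rewrite mem_index_enum.
by move=> i _; exact: hdot_ge0.
Qed.

Definition dsum_dot := mk_dot f_lin f_herm f_pos.

Let dsum_complete (u : nat -> D) :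
  dot_cauchy dsum_dot u -> exists l, dot_cvg dsum_dot u l.
Proof.
have nE x : dot_norm dsum_dot x = Num.sqrt (\sum_i nsq (x i)).
  by rewrite /dot_norm mk_dotE /f (eq_bigr _ (fun i _ => nsqE (x i))) -rmorph_sum.
move=> cu.
have c i : exists l, hcvg (fun n => u n i) l.
  apply: hcomplete => e /cu[N HN]; exists N => m n hm hn.
  apply: le_lt_trans (HN m n hm hn).
  rewrite nE ler_sqrt ?sumr_ge0 // => [|j _]; last exact: nsq_ge0.
  by rewrite (bigD1 i) //= lerDl sumr_ge0 // => j _; exact: nsq_ge0.
have [l hl] : exists l : D, forall i, hcvg (fun n => u n i) (l i).
  exists (fun i => projT1 (cid (c i))) => i; exact: (projT2 (cid (c i))).
exists l => e e0.
have eI0 : 0 < e ^+ 2 / (#|I|.+1)%:R by rewrite divr_gt0 ?exprn_gt0.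
have hN i : exists N, forall n, (N <= n)%N -> nsq (u n i - l i) < e ^+ 2 / (#|I|.+1)%:R.
  by have /hcvgP /(_ _ eI0) := hl i.
have [N HN] : exists N : I -> nat, forall i n, (N i <= n)%N ->
    nsq (u n i - l i) < e ^+ 2 / (#|I|.+1)%:R.
  by have [N HN] := choice hN; exists N.
exists (\max_i N i)%N => n hn.
rewrite nE /= -[X in _ < X](ger0_norm (ltW e0)) -sqrtr_sqr ltr_sqrt ?exprn_gt0 //.
apply: (@le_lt_trans _ _ (\sum_(i : I) e ^+ 2 / (#|I|.+1)%:R)).
  apply: ler_sum => i _; apply: ltW; apply: HN.
  by apply: leq_trans hn; exact: leq_bigmax.
rewrite sumr_const -[X in X < _]mulr_natr -mulrA -[X in _ < X]mulr1.
rewrite ltr_pM2l ?exprn_gt0 // mulrC ltr_pdivrMr // mul1r.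
by rewrite ltr_nat.
Qed.

HB.instance Definition _ := isHilbert.Build R D dsum_complete.

Lemma hdot_dsumE x y : '[x, y] = \sum_i '[x i, y i]. Proof. by []. Qed.

End DirectSum.

Lemma hdot_pairE (R : realType) (V W : hilbertType R) (x y : V * W) :
  '[x, y] = '[x.1, y.1] + '[x.2, y.2].
Proof. by []. Qed.

Record closed_subspace (R : realType) (V : hilbertType R) := ClosedSubspace {
  cs_set :> V -> Prop;
  cs_zero : cs_set 0;
  cs_linear : forall (a : R[i]) x y, cs_set x -> cs_set y -> cs_set (a *: x + y);
  cs_closed : forall (u : nat -> V) l,
    (forall n, cs_set (u n)) -> hcvg u l -> cs_set l
}.

Section ClosedSubspace.
Variables (R : realType) (V : hilbertType R) (M : closed_subspace V).

Definition cs_pred : {pred V} := fun x => `[< M x >].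

Let cs_submod_closed : submod_closed cs_pred.
Proof.
split=> [|a x y]; first by apply/asboolP; exact: cs_zero.
by move=> /asboolP Mx /asboolP My; apply/asboolP; exact: cs_linear.
Qed.

HB.instance Definition _ := GRing.isSubmodClosed.Build R[i] V cs_pred
  (GRing.submod_closed_semi cs_submod_closed).

Record cs_space := CsSpace { cs_val :> V; cs_valP : cs_val \in cs_pred }.

HB.instance Definition _ := [isSub for cs_val].
HB.instance Definition _ := [Choice of cs_space by <:].
HB.instance Definition _ := [SubChoice_isSubLmodule of cs_space by <:].

End ClosedSubspace.

Section ClosedSubspaceHilbert.
Variables (R : realType) (V : hilbertType R) (M : closed_subspace V).
Implicit Types x y z : cs_space M.

Lemma cs_valK x : M (cs_val x).
Proof. by have := cs_valP x; rewrite /cs_pred => /asboolP. Qed.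

Definition cs_elt (v : V) (Mv : M v) : cs_space M :=
  CsSpace (introT (asboolP _) Mv : v \in cs_pred M).

Lemma cs_valD x y : cs_val (x + y) = cs_val x + cs_val y.
Proof. exact: (raddfD (\val : cs_space M -> V)). Qed.

Lemma cs_valB x y : cs_val (x - y) = cs_val x - cs_val y.
Proof. exact: (raddfB (\val : cs_space M -> V)). Qed.

Lemma cs_val0 : cs_val (0 : cs_space M) = 0.
Proof. exact: (raddf0 (\val : cs_space M -> V)). Qed.

Lemma cs_valZ (a : R[i]) x : cs_val (a *: x) = a *: cs_val x.
Proof. exact: (linearZ_LR (\val : cs_space M -> V)). Qed.

Lemma cs_val_inj : injective (@cs_val R V M). Proof. exact: val_inj. Qed.

Let f x y : R[i] := '[cs_val x, cs_val y].
Let f_lin a x y z : f (a *: x + y) z = a * f x z + f y z.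
Proof. by rewrite /f cs_valD cs_valZ hdotPl. Qed.
Let f_herm x y : f x y = conjC (f y x).
Proof. exact: hdotC. Qed.
Let f_pos x : x != 0 -> 0 < f x x.
Proof.
move=> x0; apply: hdot_gt0; apply: contraNneq x0 => h.
by apply/eqP; apply: cs_val_inj; rewrite h cs_val0.
Qed.

Definition cs_dot := mk_dot f_lin f_herm f_pos.

Let cs_complete (u : nat -> cs_space M) :
  dot_cauchy cs_dot u -> exists l, dot_cvg cs_dot u l.
Proof.
have nE x : dot_norm cs_dot x = hnorm (cs_val x) by [].
move=> cu; have [|l hl] := @hcomplete R V (fun n => cs_val (u n)).
  by move=> e /cu[N HN]; exists N => m n hm hn; have := HN m n hm hn; rewrite nE cs_valB.
have Ml : M l by apply: cs_closed hl => n; exact: cs_valK.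
by exists (cs_elt Ml) => e /hl[N HN]; exists N => n /HN; rewrite nE cs_valB.
Qed.

HB.instance Definition _ := isHilbert.Build R (cs_space M) cs_complete.

Lemma hdot_csE x y : '[x, y] = '[cs_val x, cs_val y]. Proof. by []. Qed.

End ClosedSubspaceHilbert.

Coercion cs_space : closed_subspace >-> Sortclass.

Section ClosedSpan.
Variables (R : realType) (V : hilbertType R) (G : set V).

Definition in_cspan (x : V) : Prop :=
  forall M : closed_subspace V, (forall g, G g -> M g) -> M x.

Lemma cspan_zero : in_cspan 0.
Proof. by move=> M _; exact: cs_zero. Qed.

Lemma cspan_linear (a : R[i]) x y :
  in_cspan x -> in_cspan y -> in_cspan (a *: x + y).
Proof. by move=> hx hy M hM; apply: cs_linear; [exact: hx|exact: hy]. Qed.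

Lemma cspan_closed (u : nat -> V) l :
  (forall n, in_cspan (u n)) -> hcvg u l -> in_cspan l.
Proof. by move=> hu ul M hM; apply: cs_closed ul => n; exact: hu. Qed.

Definition cspan : closed_subspace V :=
  ClosedSubspace cspan_zero cspan_linear cspan_closed.

End ClosedSpan.

Section Operators.
Variable R : realType.
Implicit Types V W : hilbertType R.

Definition bounded_op V W (T : V -> W) : Prop :=
  linear T /\ exists c : R, forall x, hnorm (T x) <= c * hnorm x.

Definition contraction V W (T : V -> W) : Prop :=
  linear T /\ forall x, hnorm (T x) <= hnorm x.

Definition strict_contraction V W (T : V -> W) : Prop :=
  linear T /\ exists2 r : R, r < 1 & forall x, hnorm (T x) <= r * hnorm x.

(* For bounded T this is the Hilbert space adjoint: the set below is then a *)
(* singleton for every y, by the Riesz representation theorem.              *)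
Definition adj V W (T : V -> W) : W -> V :=
  fun y => xget 0 [set x | forall v, '[T v, y] = '[v, x]].

Definition is_unitary V W (T : V -> W) : Prop :=
  [/\ linear T, forall x y, '[T x, T y] = '[x, y] & forall y, exists x, T x = y].

Record unitary V W := Unitary {
  unitary_fun :> V -> W;
  unitaryP : is_unitary unitary_fun
}.

Definition op_has_sum (J : eqType) V W (F : J -> V -> W) (T : V -> W) : Prop :=
  forall eps : R, 0 < eps ->
  exists A0 : seq J, forall A : seq J, uniq A -> {subset A0 <= A} ->
    forall x, hnorm (\sum_(j <- A) F j x - T x) <= eps * hnorm x.

Record hilbert_tensor (V X : hilbertType R) := HilbertTensor {
  ht_space :> hilbertType R;
  ht_tensor : V -> X -> ht_space;
  ht_linearl : forall x, linear (ht_tensor^~ x);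
  ht_linearr : forall v, linear (ht_tensor v);
  ht_dot : forall v x w y,
    '[ht_tensor v x, ht_tensor w y] = '[v, w] * '[x, y];
  ht_dense : forall M : closed_subspace ht_space,
    (forall v x, M (ht_tensor v x)) -> forall t, M t
}.

End Operators.

Section Blocks.
Variable R : realType.

Section Blocks2.
Variables (V1 V2 W1 W2 : hilbertType R) (T : V1 * V2 -> W1 * W2).
Definition blk11 (x : V1) : W1 := (T (x, 0)).1.
Definition blk12 (x : V2) : W1 := (T (0, x)).1.
Definition blk21 (x : V1) : W2 := (T (x, 0)).2.
Definition blk22 (x : V2) : W2 := (T (0, x)).2.
End Blocks2.

Section Blocks3.
Variables (V1 V2 V3 W1 W2 W3 : hilbertType R).
Variable T : V1 * V2 * V3 -> W1 * W2 * W3.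
Definition tblk11 (x : V1) : W1 := (T (x, 0, 0)).1.1.
Definition tblk12 (x : V2) : W1 := (T (0, x, 0)).1.1.
Definition tblk13 (x : V3) : W1 := (T (0, 0, x)).1.1.
Definition tblk21 (x : V1) : W2 := (T (x, 0, 0)).1.2.
Definition tblk22 (x : V2) : W2 := (T (0, x, 0)).1.2.
Definition tblk23 (x : V3) : W2 := (T (0, 0, x)).1.2.
Definition tblk31 (x : V1) : W3 := (T (x, 0, 0)).2.
Definition tblk32 (x : V2) : W3 := (T (0, x, 0)).2.
End Blocks3.

End Blocks.

(* A formal series sum_n f_n z^n is the family n |-> f_n of its             *)
(* coefficients; a kernel sum_(n,m) K_(n,m) z^n w^-m is the family          *)
(* n, m |-> K_(n,m).                                                        *)

Notation multiindex d := {ffun 'I_d -> int}.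
Notation natindex d := {ffun 'I_d -> nat}.

Section Series.
Variables (R : realType) (d : nat).
Local Notation mindex := (multiindex d).

Definition evec (k : 'I_d) : mindex := [ffun j => (j == k)%:Z].
Definition of_natindex (p : natindex d) : mindex := [ffun k => (p k)%:Z].
Definition mnonneg (n : mindex) : bool := [forall k, 0 <= n k].

Definition kernel (G : hilbertType R) := mindex -> mindex -> G -> G.

Definition positive_kernel (G : hilbertType R) (K : kernel G) : Prop :=
  forall (A : seq mindex) (u : mindex -> G), uniq A ->
    0 <= \sum_(n <- A) \sum_(m <- A) '[K n m (u m), u n].

(* z_k K(z, w) w_k^-1 *)
Definition shift_kernel (G : hilbertType R) (k : 'I_d) (K : kernel G) :
  kernel G := fun n m => K (n - evec k) (m - evec k).

(* H(K): a Hilbert space of formal series (rk_coef is injective, so its     *)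
(* elements are series) which contains every [K]_m u and has the            *)
(* reproducing property. These properties determine it uniquely.            *)
Record rkhs (G : hilbertType R) (K : kernel G) := RKHS {
  rk_space :> hilbertType R;
  rk_coef : rk_space -> mindex -> G;
  rk_coef_linear : forall n, linear (rk_coef^~ n);
  rk_coef_inj : injective rk_coef;
  rk_kern : mindex -> G -> rk_space;
  rk_kernE : forall m u n, rk_coef (rk_kern m u) n = K n m u;
  rk_reproducing : forall f m u, '[f, rk_kern m u] = '[rk_coef f m, u]
}.

(* The coefficient of z^n in (z_1 M_1 + ... + z_d M_d)^j.                   *)
Fixpoint geom_pow (H : hilbertType R) (M : 'I_d -> H -> H) (j : nat)
    (n : mindex) (x : H) : H :=
  if j is j'.+1 then \sum_k M k (geom_pow M j' (n - evec k) x)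
  else if n == 0 then x else 0.

(* The coefficient of z^n in (I - (z_1 M_1 + ... + z_d M_d))^-1; only the   *)
(* j-th power with j = |n_1| + ... + |n_d| can contribute to it.            *)
Definition geom (H : hilbertType R) (M : 'I_d -> H -> H) (n : mindex) (x : H) :
  H := \sum_(j < (\sum_k absz (n k)).+1) geom_pow M j n x.

Variables E Es : hilbertType R.
Implicit Type S : mindex -> E -> Es.

Definition op_pow (X : hilbertType R) (T : 'I_d -> X -> X) (p : natindex d) :
  X -> X := foldr (fun k f => iter (p k) (T k) \o f) id (enum 'I_d).

Definition schur_agler S : Prop :=
  [/\ forall n, bounded_op (S n),
      forall n, ~~ mnonneg n -> forall e, S n e = 0,
      (* sum_p S_p z^p converges in operator norm on the polydisk, i.e. S is *)
      (* the Taylor series of a holomorphic function there *)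
      forall z : 'I_d -> R[i], (forall k, `|z k| < 1) ->
        exists Sz : E -> Es,
          op_has_sum (fun (p : natindex d) e =>
            (\prod_k z k ^+ p k) *: S (of_natindex p) e) Sz
    & forall (X : hilbertType R) (T : 'I_d -> X -> X),
        (forall k, strict_contraction (T k)) ->
        (forall j k x, T j (T k x) = T k (T j x)) ->
      forall (EX : hilbert_tensor E X) (EsX : hilbert_tensor Es X),
      exists (F : natindex d -> EX -> EsX) (ST : EX -> EsX),
        [/\ forall p, bounded_op (F p),
            forall p e x, F p (ht_tensor EX e x) =
              ht_tensor EsX (S (of_natindex p) e) (op_pow T p x),
            op_has_sum F ST
          & contraction ST]].

(* The coefficient of z^n w^-m in                                           *)
(*   [ I - S(z)S(w)^*      S(w) - S(z)     ]                                *)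
(*   [ S(z)^* - S(w)^*     S(z)^*S(w) - I  ],                               *)
(* where S(z)^* = sum_n S_n^* z^-n.                                         *)
Definition agler_kernel S : kernel (Es * E)%type := fun n m u =>
  let D (G : hilbertType R) (a : mindex) (x : G) := if a == 0 then x else 0 in
  let es := u.1 in let e := u.2 in
  ( (D Es n (D Es m es) - S n (adj (S m) es))
    + (D Es n (S (- m) e) - D Es m (S n e)),
    (D E m (adj (S (- n)) es) - D E n (adj (S m) es))
    + (adj (S (- n)) (S (- m) e) - D E n (D E m e)) ).

Definition augmented_agler S (K : 'I_d -> kernel (Es * E)%type) : Prop :=
  (forall k, positive_kernel (K k) /\
     exists (X : hilbertType R) (H1 : mindex -> X -> Es) (H2 : mindex -> X -> E),
     let H n x : Es * E := (H1 n x, H2 n x) in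
     [/\ forall n, bounded_op (H n),
         forall n, ~~ mnonneg n -> forall x, H1 n x = 0,
         forall n, ~~ mnonneg (- (n + evec k)) -> forall x, H2 n x = 0
       & forall n m u, K k n m u = H n (adj (H m) u)])
  /\ forall n m u,
       agler_kernel S n m u = \sum_k (K k n m u - shift_kernel k (K k) n m u).

End Series.

(* H is the orthogonal direct sum of the ranges of the P_k. *)
Definition orth_decomposition (R : realType) (d : nat) (H : hilbertType R)
    (P : 'I_d -> H -> H) : Prop :=
  [/\ forall k, linear (P k),
      forall k x y, '[P k x, y] = '[x, P k y],
      forall j k x, P j (P k x) = if j == k then P k x else 0
    & forall x, \sum_k P k x = x].

Record colligation (R : realType) (d : nat) (E Es : hilbertType R) :=
  Colligation {
    state : hilbertType R;
    proj : 'I_d -> state -> state;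
    proj_decomposition : orth_decomposition proj;
    opU : unitary (state * E)%type (state * Es)%type
  }.

Arguments state {R d E Es} c.
Arguments proj {R d E Es} c k x.
Arguments opU {R d E Es} c.

Section ColligationBlocks.
Variables (R : realType) (d : nat) (E Es : hilbertType R).
Variable c : colligation d E Es.
Definition opA : state c -> state c := blk11 (opU c).
Definition opB : E -> state c := blk12 (opU c).
Definition opC : state c -> Es := blk21 (opU c).
Definition opD : E -> Es := blk22 (opU c).
End ColligationBlocks.

Arguments opA {R d E Es} c x.
Arguments opB {R d E Es} c e.
Arguments opC {R d E Es} c x.
Arguments opD {R d E Es} c e.

Section Colligations.
Variables (R : realType) (d : nat) (E Es : hilbertType R).
Local Notation mindex := (multiindex d).
Implicit Type c : colligation d E Es.

(* S(z) = D + C (I - Z(z)A)^-1 Z(z)B *)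
Definition realizes c (S : mindex -> E -> Es) : Prop :=
  forall n e, S n e =
    (if n == 0 then opD c e else 0)
    + \sum_k opC c (geom (fun j => proj c j \o opA c) (n - evec k)
                         (proj c k (opB c e))).

(* The coefficient of z^n in                                                *)
(*   [ C (I - Z(z)A)^-1 ; z_k^-1 B^* (I - Z(z)^-1 A^* )^-1 ].               *)
Definition left_factor c (k : 'I_d) (n : mindex) (x : state c) : Es * E :=
  ( opC c (geom (fun j => proj c j \o opA c) n x),
    adj (opB c) (geom (fun j => proj c j \o adj (opA c)) (- (n + evec k)) x) ).

(* The coefficient of w^-m in                                               *)
(*   [ (I - A^* Z(w)^-1)^-1 C^*   (I - A Z(w))^-1 B w_k ].                  *)
Definition right_factor c (k : 'I_d) (m : mindex) (u : Es * E) : state c :=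
  geom (fun j => adj (opA c) \o proj c j) m (adj (opC c) u.1)
  + geom (fun j => opA c \o proj c j) (- (m + evec k)) (opB c u.2).

Definition compatible c (K : 'I_d -> kernel d (Es * E)%type) : Prop :=
  forall k n m u,
    K k n m u = left_factor k n (proj c k (right_factor c k m u)).

Definition closely_connected c : Prop :=
  forall M : closed_subspace (state c),
    (forall e, M (opB c e)) ->
    (forall es, M (adj (opC c) es)) ->
    (forall x, M x -> M (opA c x)) ->
    (forall x, M x -> M (adj (opA c) x)) ->
    (forall k x, M x -> M (proj c k x)) ->
    forall x, M x.

Definition intertwines c c' (tau : unitary (state c) (state c')) : Prop :=
  (forall k x, tau (proj c k x) = proj c' k (tau x)) /\
  (forall x e, opU c' (tau x, e) = (tau (opU c (x, e)).1, (opU c (x, e)).2)).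

Definition unitarily_equivalent c c' : Prop :=
  exists tau : unitary (state c) (state c'), intertwines tau.

End Colligations.

Definition reducing (R : realType) (d : nat) (E Es : hilbertType R)
    (c : colligation d E Es) (M : closed_subspace (state c)) : Prop :=
  [set opU c (x, 0) | x in [set x | M x]] = [set (y, 0) | y in [set y | M y]].

Section DirectSumColligation.
Variables (R : realType) (d : nat).

Definition dsum_proj (H : 'I_d -> hilbertType R) (k : 'I_d) (x : dsum H) :
  dsum H := fun j => if j == k then x j else 0.

Lemma dsum_proj_decomposition (H : 'I_d -> hilbertType R) :
  orth_decomposition (@dsum_proj H).
Proof.
split.
- move=> k a x y; apply: functional_extensionality_dep => j.
  rewrite /dsum_proj !(dsumD, dsumZ); case: ifP => // _.
  by rewrite scaler0 addr0.
- move=> k x y; rewrite !hdot_dsumE; apply: eq_bigr => j _; rewrite /dsum_proj.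
  by case: ifP => // _; rewrite hdot0l hdotC hdot0l conjC0.
- move=> j k x; apply: functional_extensionality_dep => i; rewrite /dsum_proj.
  have [->|jk] := eqVneq j k; first by case: (i == k).
  by rewrite dsum0; have [->|//] := eqVneq i j; rewrite (negPf jk).
- move=> x; apply: functional_extensionality_dep => i.
  have -> : (\sum_k dsum_proj k x) i = \sum_k dsum_proj k x i.
    exact: (big_morph (fun y : dsum H => y i) (id1 := 0) (op1 := +%R)).
  by rewrite (bigD1 i) //= /dsum_proj eqxx big1 ?addr0 // => k; rewrite eq_sym => /negPf->.
Qed.

Definition dsum_colligation (F Fs : hilbertType R) (H : 'I_d -> hilbertType R)
    (U : unitary (dsum H * F)%type (dsum H * Fs)%type) : colligation d F Fs :=
  Colligation (dsum_proj_decomposition H) U.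

(* The state space (+)_k (H1_k (+) H2_k), written as (+)_k H1_k (+) (+)_k H2_k, *)
(* with P_k the projection onto H1_k (+) H2_k.                              *)
Definition dsum2_proj (H1 H2 : 'I_d -> hilbertType R) (k : 'I_d)
  (x : dsum H1 * dsum H2) : dsum H1 * dsum H2 :=
  (dsum_proj k x.1, dsum_proj k x.2).

Lemma dsum2_proj_decomposition (H1 H2 : 'I_d -> hilbertType R) :
  orth_decomposition (@dsum2_proj H1 H2).
Proof.
have [l1 s1 o1 t1] := dsum_proj_decomposition H1.
have [l2 s2 o2 t2] := dsum_proj_decomposition H2.
split.
- by move=> k a x y; rewrite /dsum2_proj /= l1 l2.
- by move=> k x y; rewrite !hdot_pairE /= s1 s2.
- by move=> j k x; rewrite /dsum2_proj /= o1 o2; case: ifP.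
- move=> x; rewrite [LHS]surjective_pairing [RHS]surjective_pairing.
  rewrite (big_morph fst (id1 := 0) (op1 := +%R)) //.
  by rewrite (big_morph snd (id1 := 0) (op1 := +%R)) // t1 t2.
Qed.

Definition dsum2_colligation (F Fs : hilbertType R)
    (H1 H2 : 'I_d -> hilbertType R)
    (U : unitary (dsum H1 * dsum H2 * F)%type (dsum H1 * dsum H2 * Fs)%type) :
  colligation d F Fs := Colligation (dsum2_proj_decomposition H1 H2) U.

End DirectSumColligation.

Section Overlapping.
Variables (R : realType) (d : nat) (G : hilbertType R).
Variables (K : 'I_d -> kernel d G) (HK : forall k, rkhs (K k)).

Definition in_overlapping (f : dsum HK) : Prop :=
  forall n, \sum_k rk_coef (f k) n = 0.

Lemma overlapping_zero : in_overlapping 0.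
Proof.
move=> n; rewrite big1 // => k _.
by have := @rk_coef_linear _ _ _ _ (HK k) n (-1) 0 0; rewrite /= scaler0 addr0 scaleN1r addNr.
Qed.

Lemma overlapping_linear (a : R[i]) f g :
  in_overlapping f -> in_overlapping g -> in_overlapping (a *: f + g).
Proof.
move=> hf hg n; transitivity (a *: \sum_k rk_coef (f k) n + \sum_k rk_coef (g k) n).
  rewrite scaler_sumr -big_split; apply: eq_bigr => k _.
  exact: (@rk_coef_linear _ _ _ _ (HK k) n a (f k) (g k)).
by rewrite hf hg scaler0 addr0.
Qed.

Lemma overlapping_closed (u : nat -> dsum HK) f :
  (forall j, in_overlapping (u j)) -> hcvg u f -> in_overlapping f.
Proof.
have sumE (g : dsum HK) n v : '[\sum_k rk_coef (g k) n, v] =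
    '[g, (fun k => rk_kern (HK k) n v) : dsum HK].
  rewrite hdot_suml hdot_dsumE; apply: eq_bigr => k _.
  by rewrite rk_reproducing.
move=> hu uf n; apply: hdot_eq0; rewrite sumE; apply: hcvg_orth uf _ => j.
by rewrite -sumE hu hdot0l.
Qed.

Definition overlapping : closed_subspace (dsum HK) :=
  ClosedSubspace overlapping_zero overlapping_linear overlapping_closed.

End Overlapping.

Section Model.
Variables (R : realType) (d : nat) (E Es : hilbertType R).
Local Notation mindex := (multiindex d).
Variable S : mindex -> E -> Es.
Variable K : 'I_d -> kernel d (Es * E)%type.
Variable HK : forall k, rkhs (K k).
Variable HK' : forall k, rkhs (shift_kernel k (K k)).

Definition gen_dom (m : mindex) (es : Es) (e : E) : dsum HK * E :=
  ((fun k => rk_kern (HK k) m (es, e)),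
   adj (S m) es + (if m == 0 then e else 0)).

Definition gen_ran (m : mindex) (es : Es) (e : E) : dsum HK * Es :=
  ((fun k => rk_kern (HK k) (m - evec k) (es, e)),
   (if m == 0 then es else 0) + S (- m) e).

Definition Vdom : closed_subspace (dsum HK * E)%type :=
  cspan [set x | exists m es e, x = gen_dom m es e].

Definition Vran : closed_subspace (dsum HK * Es)%type :=
  cspan [set x | exists m es e, x = gen_ran m es e].

Definition is_V (V : unitary Vdom Vran) : Prop :=
  forall (x : Vdom) m es e,
    cs_val x = gen_dom m es e -> cs_val (V x) = gen_ran m es e.

(* (+)_k f_k |-> (+)_k z_k^-1 f_k, from (+)_k H(K'_k) onto (+)_k H(K_k) *)
Definition jmap (f : dsum HK') : dsum HK := fun k =>
  xget 0 [set g : HK k | forall n, rk_coef g n = rk_coef (f k) (n + evec k)].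

Local Notation L := (overlapping HK).
Local Notation L' := (overlapping HK').

Definition is_U0 (V : unitary Vdom Vran)
    (U0 : unitary (dsum HK * E * L')%type (dsum HK * Es * L)%type) : Prop :=
  [/\ forall x : Vdom, U0 (cs_val x, 0) = (cs_val (V x), 0),
      forall l : L, U0 (cs_val l, 0, 0) = (0, 0, l)
    & forall l' : L', U0 (0, 0, l') = (jmap (cs_val l'), 0, 0)].

Section Extension.
Variable Ht : 'I_d -> hilbertType R.

Definition extension :=
  unitary (dsum HK * dsum Ht * E)%type (dsum HK * dsum Ht * Es)%type.
Definition load :=
  unitary (dsum Ht * L)%type (dsum Ht * L')%type.

Definition extends_V (V : unitary Vdom Vran) (U : extension) : Prop :=
  forall x : Vdom, U ((cs_val x).1, 0, (cs_val x).2) =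
                   ((cs_val (V x)).1, 0, (cs_val (V x)).2).

Definition feedback
    (U0 : unitary (dsum HK * E * L')%type (dsum HK * Es * L)%type)
    (Ut : load) (U : extension) : Prop :=
  forall h ht e h' ht' es,
    U (h, ht, e) = (h', ht', es) <->
    exists! ll : L * L',
      U0 (h, e, ll.2) = (h', es, ll.1) /\ Ut (ht, ll.1) = (ht', ll.2).

(* The action of the block matrix                                           *)
(*   [ U0_11 + U0_13 Ut_22 U0_31   U0_13 Ut_21   U0_12 + U0_13 Ut_22 U0_32 ] *)
(*   [ Ut_12 U0_31                 Ut_11         Ut_12 U0_32               ] *)
(*   [ U0_21 + U0_23 Ut_22 U0_31   U0_23 Ut_21   U0_22 + U0_23 Ut_22 U0_32 ] *)
Definition feedback_matrix
    (U0 : unitary (dsum HK * E * L')%type (dsum HK * Es * L)%type)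
    (Ut : load) (x : dsum HK * dsum Ht * E) : dsum HK * dsum Ht * Es :=
  let h := x.1.1 in let ht := x.1.2 in let e := x.2 in
  ( ( (tblk11 U0 h + tblk13 U0 (blk22 Ut (tblk31 U0 h)))
      + tblk13 U0 (blk21 Ut ht)
      + (tblk12 U0 e + tblk13 U0 (blk22 Ut (tblk32 U0 e))),
      blk12 Ut (tblk31 U0 h) + blk11 Ut ht + blk12 Ut (tblk32 U0 e) ),
    (tblk21 U0 h + tblk23 U0 (blk22 Ut (tblk31 U0 h)))
    + tblk23 U0 (blk21 Ut ht)
    + (tblk22 U0 e + tblk23 U0 (blk22 Ut (tblk32 U0 e))) ).

End Extension.
End Model.

(* Main.v *)
Require Import Defs.
From mathcomp Require Import all_boot all_order all_algebra.
From mathcomp Require Import sesquilinear complex ring lra.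
From mathcomp Require Import boolp classical_sets reals.

Set Implicit Arguments.
Unset Strict Implicit.
Unset Printing Implicit Defensive.

Import Order.TTheory GRing.Theory Num.Theory.
Local Open Scope ring_scope.

(** Write X for the direct sum of the spaces H(K_k), T for that of the
    auxiliary spaces, and J for the isometry l' |-> z_k^-1 l'_k of L' into X.

    The supports prescribed for the augmented decomposition make the second
    component of every series in H(K_k) vanish at index 0, so that
    [K_k]_0 (0, e) = 0. Hence a vector orthogonal to D has no component in E,
    and the orthogonal complement of D is L (+) 0 ([Vdom_orth]). Since U0 is
    unitary and carries D, L, L' onto R, L, J L', the complement of R is
    J L' (+) 0 ([Vran_orth]).

    Feedback. U0 maps d + (l, 0) together with l' to V d + (J l', 0) together
    with l. The outgoing l therefore depends on (h, e) alone, and the loop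
    closing U0 with a load Ut can be solved explicitly ([loopP]). The signals l
    and l' enter and leave with equal inner products, so the closed loop is
    unitary as soon as U0 and Ut are ([closed_loop_is_unitary]). On D it acts as
    V, and on L (+) T it acts as Ut up to J; as these two subspaces span
    everything, this characterizes the closed loop ([extends_feedback]).
    Conversely, a unitary U that extends V maps the complement L (+) T of D onto
    the complement J L' (+) T of R, and what it does there is a load
    ([extension_load]). This is the parametrization, and its uniqueness.

    Reducing subspaces and equivalences. The dictionary
       Ut (t, l) = (t', l')  <->  U (l, t, 0) = (J l', t', 0)
    of [feedback_L] transfers both remaining claims. A P_k-invariant reducing
    subspace of U inside T is a subspace which Ut maps onto itself without
    emitting or absorbing signals; the complements of such subspaces are exactly
    the subspaces that closed connectedness tests. A unitary sigma between the
    auxiliary spaces intertwines the loads if and only if id (+) sigma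
    intertwines the extensions, and a unitary which is the identity on X has the
    form id (+) sigma.

    Compatible realizations. Compatibility says that the vectors
    P_k right_factor_m u of the state space have the same Gram matrix as the
    kernel functions [K_k]_m u, hence H(K_k) embeds isometrically into the range
    of P_k ([state_embedding]). The k-th auxiliary space is the complement of the
    image in that range, which identifies the state space with X (+) T. The
    transported operator extends V because the colligation carries the image of
    each generator of D to the image of the generator of R with the same index
    ([colligation_step]); that in turn is the recursion satisfied by the
    coefficients of the geometric series. *)

(** * Orthogonal projections *)

Section LinearMaps.
Variables (R : pzRingType) (V W : lmodType R) (f : V -> W).
Hypothesis f_lin : linear f.

Lemma lin0 : f 0 = 0.
Proof. by have := f_lin (-1) 0 0; rewrite scaler0 addr0 scaleN1r addNr. Qed.

Lemma linD x y : f (x + y) = f x + f y.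
Proof. by have := f_lin 1 x y; rewrite !scale1r. Qed.

Lemma linZ a x : f (a *: x) = a *: f x.
Proof. by have := f_lin a x 0; rewrite lin0 !addr0. Qed.

Lemma linB x y : f (x - y) = f x - f y.
Proof. by rewrite -scaleN1r linD linZ scaleN1r. Qed.

Lemma lin_sum I (r : seq I) (P : pred I) (F : I -> V) :
  f (\sum_(i <- r | P i) F i) = \sum_(i <- r | P i) f (F i).
Proof. exact: (big_morph f linD lin0). Qed.
End LinearMaps.

Section Projection.
Variables (R : realType) (V : hilbertType R).
Implicit Types (x y z : V) (M : closed_subspace V).

Lemma hdotDr x y z : '[x, y + z] = '[x, y] + '[x, z].
Proof. by rewrite hdotC hdotDl rmorphD /= -!hdotC. Qed.

Lemma hdot0r x : '[x, 0] = 0.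
Proof. by rewrite hdotC hdot0l conjC0. Qed.

Lemma hdot_sumr (I : Type) (r : seq I) (P : pred I) (F : I -> V) y :
  '[y, \sum_(i <- r | P i) F i] = \sum_(i <- r | P i) '[y, F i].
Proof. by rewrite hdotC hdot_suml rmorph_sum /=; apply: eq_bigr => i _; rewrite -hdotC. Qed.

Lemma hdot_ext x y : (forall z, '[x, z] = '[y, z]) -> x = y.
Proof.
by move=> h; apply/eqP; rewrite -subr_eq0; apply/eqP/hdot_eq0; rewrite hdotBl h subrr.
Qed.

Lemma parallelogram x y : nsq (x + y) + nsq (x - y) = 2 * nsq x + 2 * nsq y.
Proof.
rewrite /nsq hdotBl !hdotBr hdotDl !hdotDr !raddfB /= !raddfD /=.
by ring.
Qed.

Lemma nsq_double x : nsq (x + x) = 4 * nsq x.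
Proof.
have := parallelogram x x; rewrite subrr {2}/nsq hdot0l raddf0 addr0 => ->.
by ring.
Qed.

Lemma cs_add M x y : M x -> M y -> M (x + y).
Proof. by move=> hx hy; have := cs_linear 1 hx hy; rewrite scale1r. Qed.

Lemma cs_scale M (a : R[i]%C) x : M x -> M (a *: x).
Proof. by move=> hx; have := cs_linear a hx (cs_zero M); rewrite addr0. Qed.

Lemma cs_sub M x y : M x -> M y -> M (x - y).
Proof. by move=> hx hy; rewrite -scaleN1r; apply: cs_add => //; exact: cs_scale. Qed.

(** The step a = <x, y> / <y, y> decreases the square norm of x - a y by
    |<x, y>|^2 / <y, y>, which minimality forbids unless <x, y> = 0. *)
Lemma min_orth x y : (forall a : R[i]%C, nsq x <= nsq (x - a *: y)) -> '[x, y] = 0.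
Proof.
move=> h; have [->|y0] := eqVneq y 0; first exact: hdot0r.
have yy := hdot_gt0 y0.
have yy0 : '[y, y] != 0 by rewrite gt_eqF.
have := h ('[x, y] / '[y, y]).
have -> : (nsq x <= nsq (x - ('[x, y] / '[y, y]) *: y)) =
          ('[x, x] <= '[x, x] - '[x, y] * '[y, x] / '[y, y]).
  rewrite -lecR -!nsqE; congr (_ <= _).
  rewrite hdotBl !hdotBr !hdotZl !hdotZr rmorphM fmorphV /= -!hdotC.
  by field.
rewrite -subr_ge0 addrAC subrr add0r oppr_ge0 pmulr_lle0 ?invr_gt0 //.
rewrite [X in _ * X]hdotC -normCK => h0.
by apply/eqP; rewrite -normr_eq0 -sqrf_eq0 eq_le h0 exprn_ge0.
Qed.

Definition dist2s M x : set R := [set nsq (x - m) | m in [set m | M m]]%classic.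

(** By the parallelogram law a minimizing sequence for the distance is a Cauchy
    sequence; its limit minimizes the distance, hence is the projection. *)
Lemma projection_exists M x : exists p, M p /\ forall m, M m -> '[x - p, m] = 0.
Proof.
pose delta := inf (dist2s M x).
have hlb : has_lbound (dist2s M x) by exists 0 => _ [m _ <-]; exact: nsq_ge0.
have hinf : has_inf (dist2s M x).
  by split=> //; exists (nsq (x - 0)); exists 0 => //; exact: cs_zero.
have dlb m : M m -> delta <= nsq (x - m) by move=> Mm; apply: ge_inf => //; exists m.
have /choice[m mP] : forall n, exists y, M y /\ nsq (x - y) < delta + (n.+1%:R : R)^-1.
  move=> n; have e0 : 0 < (n.+1%:R : R)^-1 by rewrite invr_gt0.
  by have [_ [y My <-] hy] := inf_adherent e0 hinf; exists y.
have mdist i j : nsq (m i - m j) <= 2 * (i.+1%:R)^-1 + 2 * (j.+1%:R)^-1.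
  have [Mi hi] := mP i; have [Mj hj] := mP j.
  pose c := 2^-1 *: (m i + m j) : V.
  have Mc : M c by apply: cs_scale; exact: cs_add.
  have cc : c + c = m i + m j.
    rewrite -scalerDl (_ : 2^-1 + 2^-1 = 1 :> R[i]%C) ?scale1r //; by field.
  have := parallelogram (x - m j) (x - m i).
  have -> : x - m j + (x - m i) = (x - c) + (x - c).
    by rewrite addrACA [RHS]addrACA -!opprD cc [m j + _]addrC.
  have -> : x - m j - (x - m i) = m i - m j.
    by rewrite opprB addrC addrA subrK.
  rewrite nsq_double; move: hi hj (dlb _ Mc).
  move: (nsq _) (nsq _) (nsq _) (nsq _) (_^-1) (_^-1) (delta) => a b c' e u v D; lra.
have invN e : 0 < e -> exists N, forall n, (N <= n)%N -> (n.+1%:R : R)^-1 < e.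
  move=> e0; exists (Num.truncn e^-1) => n hn.
  rewrite invf_plt ?posrE //; apply: lt_le_trans (truncnS_gt _) _.
  by rewrite ler_nat ltnS.
have [p mp] : exists p, hcvg m p.
  apply: hcomplete; apply/hcauchyP => e e0.
  have [|N HN] := invN (e / 4); first by rewrite divr_gt0.
  exists N => i j hi hj; apply: le_lt_trans (mdist i j) _.
  move: (HN i hi) (HN j hj); move: (i.+1%:R^-1) (j.+1%:R^-1) => u v; lra.
have Mp : M p by apply: cs_closed mp => n; case: (mP n).
exists p; split=> // y My; apply: min_orth => a.
apply: (@le_trans _ _ delta); last first.
  by rewrite -addrA -opprD; apply: dlb; apply: cs_add => //; exact: cs_scale.
apply/ler_addgt0Pr => e e0.
have [|N HN] := invN (e / 4); first by rewrite divr_gt0.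
have [|N' HN'] := (hcvgP _ _).1 mp (e / 4); first by rewrite divr_gt0.
pose n := maxn N N'.
have h1 := HN n (leq_maxl _ _); have h2 := HN' n (leq_maxr _ _).
have [Mn h3] := mP n.
have h4 : delta <= nsq (x - m n - (m n - p)).
  by rewrite -addrA -opprD; apply: dlb; apply: cs_add => //; exact: cs_sub.
(* The reflected point 2 m_n - p lies in M as well, so it is at square
   distance at least delta from x; this bounds the distance from x to p. *)
have := parallelogram (x - m n) (m n - p); rewrite addrA subrK.
move: h1 h2 h3 h4.
move: (nsq _) (nsq _) (nsq _) (nsq _) (n.+1%:R^-1) (delta) => b c f g u D; lra.
Qed.

End Projection.

(** * Orthogonal complements, adjoints and unitary operators *)

Section Pairs.
Variables (R : realType) (V W : hilbertType R).

Lemma pair_addE (a c : V) (b e : W) : (a, b) + (c, e) = (a + c, b + e).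
Proof. by []. Qed.

Lemma pair_scaleE (k : R[i]%C) (a : V) (b : W) : k *: (a, b) = (k *: a, k *: b).
Proof. by []. Qed.
End Pairs.

Section Orthogonal.
Variables (R : realType) (V : hilbertType R).
Implicit Types (x y : V) (G : set V) (M : closed_subspace V).

Definition in_orth G x := forall g, G g -> '[x, g] = 0.

Lemma orth_zero G : in_orth G 0.
Proof. by move=> g _; rewrite hdot0l. Qed.

Lemma orth_linear G (a : R[i]%C) x y :
  in_orth G x -> in_orth G y -> in_orth G (a *: x + y).
Proof. by move=> hx hy g Gg; rewrite hdotPl hx // hy // mulr0 addr0. Qed.

Lemma orth_closed G (u : nat -> V) l :
  (forall n, in_orth G (u n)) -> hcvg u l -> in_orth G l.
Proof. by move=> hu ul g Gg; apply: hcvg_orth ul _ => n; exact: hu. Qed.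

Definition orth G : closed_subspace V :=
  ClosedSubspace (@orth_zero G) (@orth_linear G) (@orth_closed G).

Lemma cspan_gen G g : G g -> cspan G g.
Proof. by move=> Gg M; apply. Qed.

Lemma cspan_orth G x y : (forall g, G g -> '[g, x] = 0) -> cspan G y -> '[y, x] = 0.
Proof. by move=> h /(_ (orth (set1 x)))-> // g /h gx z ->. Qed.

Lemma orthC x y : '[x, y] = 0 -> '[y, x] = 0.
Proof. by move=> h; rewrite hdotC h conjC0. Qed.

Lemma closed_full M : (forall x, (forall m, M m -> '[x, m] = 0) -> x = 0) ->
  forall x, M x.
Proof.
move=> h x; have [p [Mp /h/eqP]] := projection_exists M x.
by rewrite subr_eq0 => /eqP->.
Qed.
End Orthogonal.

Section Adjoint.
Variables (R : realType) (V W : hilbertType R).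

Lemma adjE (T : V -> W) y x : (forall v, '[T v, y] = '[v, x]) -> adj T y = x.
Proof.
move=> h; rewrite /adj; case: xgetP => [z _ hz|/(_ x)]; last by case.
by apply: hdot_ext => v; rewrite hdotC -hz h -hdotC.
Qed.

Lemma adj0 (T : V -> W) : adj T 0 = 0.
Proof. by apply: adjE => v; rewrite !hdot0r. Qed.

(** An operator with an adjoint is continuous enough for this purpose: the vectors
    on which two of them agree form an orthogonal complement, which is closed. *)
Lemma eq_on_cspan (G : set V) (T T' : V -> W) (T1 T1' : W -> V) :
  (forall x y, '[T x, y] = '[x, T1 y]) ->
  (forall x y, '[T' x, y] = '[x, T1' y]) ->
  (forall g, G g -> T g = T' g) -> forall x, cspan G x -> T x = T' x.
Proof.
move=> hT hT' h x Gx; apply: hdot_ext => z; apply/eqP.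
rewrite -subr_eq0 hT hT' -hdotBr; apply/eqP; apply: cspan_orth Gx => g Gg.
by rewrite hdotBr -hT -hT' h // subrr.
Qed.
End Adjoint.

Section Unitary.
Variables (R : realType) (V W : hilbertType R).
Implicit Type U : unitary V W.

Lemma uni_lin U : linear U. Proof. by case: U => f []. Qed.

Lemma uni_dot U x y : '[U x, U y] = '[x, y]. Proof. by case: U => f []. Qed.

Lemma uni_surj U y : exists x, U x = y. Proof. by case: U => f []. Qed.

Lemma isometry_inj (f : V -> W) : linear f ->
  (forall x y, '[f x, f y] = '[x, y]) -> injective f.
Proof.
move=> fl fd x y e; apply/eqP; rewrite -subr_eq0; apply/eqP/hdot_eq0.
by rewrite -fd linB // e subrr hdot0l.
Qed.

Lemma uni_inj U : injective U.
Proof. exact: isometry_inj (uni_lin U) (uni_dot U). Qed.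

Lemma uni_ext U U' : (forall x, U x = U' x) -> U = U'.
Proof.
case: U U' => f hf [g hg] /= h; have e : f = g by apply/funext.
by rewrite -e in hg *; congr Unitary; exact: Prop_irrelevance.
Qed.

Lemma uni_inverse U : exists T : unitary W V, cancel T U.
Proof.
have [f fK] := choice (uni_surj U).
have fu : Defs.is_unitary f; last by exists (Unitary fu).
split=> [a x y|x y|x].
- by apply: (@uni_inj U); rewrite uni_lin !fK.
- by rewrite -(uni_dot U) !fK.
- by exists (U x); apply: (@uni_inj U); rewrite fK.
Qed.

(** The inverse is chosen from its existence, so that it does not unfold
    during simplification. *)
Definition uinv U : unitary W V := projT1 (cid (uni_inverse U)).

Lemma uinvK U : cancel (uinv U) U.
Proof. exact: projT2 (cid (uni_inverse U)). Qed.

Lemma uniK U : cancel U (uinv U).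
Proof. by move=> x; apply: (@uni_inj U); rewrite uinvK. Qed.

Lemma uni_adj U x y : '[U x, y] = '[x, uinv U y].
Proof. by rewrite -[in LHS](uinvK U y) uni_dot. Qed.
End Unitary.

Lemma uinvE (R : realType) (V W : hilbertType R) (U : unitary V W) : uinv (uinv U) = U.
Proof. by apply: uni_ext => x; apply: (@uni_inj _ _ _ (uinv U)); rewrite uinvK uniK. Qed.

(** For a unitary operator U^* = U^-1, so the adjoints of its blocks are given
    explicitly, with no appeal to a representation theorem. *)
Section Blocks.
Variables (R : realType) (V1 V2 W1 W2 : hilbertType R).

Section LinearBlocks.
Variable T : V1 * V2 -> W1 * W2.
Hypothesis T_lin : linear T.

Lemma blkE x y : T (x, y) = (blk11 T x + blk12 T y, blk21 T x + blk22 T y).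
Proof.
have -> : (x, y) = (x, 0) + (0, y) by rewrite pair_addE addr0 add0r.
by rewrite (linD T_lin) [LHS]surjective_pairing.
Qed.

Let inl_lin a x y : (a *: x + y, 0) = a *: (x, 0) + (y, 0) :> V1 * V2.
Proof. by rewrite pair_scaleE pair_addE scaler0 addr0. Qed.

Let inr_lin a x y : (0, a *: x + y) = a *: (0, x) + (0, y) :> V1 * V2.
Proof. by rewrite pair_scaleE pair_addE scaler0 addr0. Qed.

Lemma blk11_lin : linear (blk11 T).
Proof. by move=> a x y; rewrite /blk11 inl_lin T_lin. Qed.

Lemma blk12_lin : linear (blk12 T).
Proof. by move=> a x y; rewrite /blk12 inr_lin T_lin. Qed.

Lemma blk21_lin : linear (blk21 T).
Proof. by move=> a x y; rewrite /blk21 inl_lin T_lin. Qed.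

Lemma blk22_lin : linear (blk22 T).
Proof. by move=> a x y; rewrite /blk22 inr_lin T_lin. Qed.
End LinearBlocks.

Variable U : unitary (V1 * V2)%type (W1 * W2)%type.

Lemma blk11_dot x y : '[blk11 U x, y] = '[x, blk11 (uinv U) y].
Proof.
by have := uni_adj U (x, 0) (y, 0); rewrite !hdot_pairE /= hdot0r hdot0l !addr0.
Qed.

Lemma blk12_dot x y : '[blk12 U x, y] = '[x, blk21 (uinv U) y].
Proof.
by have := uni_adj U (0, x) (y, 0); rewrite !hdot_pairE /= hdot0r hdot0l addr0 add0r.
Qed.

Lemma blk21_dot x y : '[blk21 U x, y] = '[x, blk12 (uinv U) y].
Proof.
by have := uni_adj U (x, 0) (0, y); rewrite !hdot_pairE /= hdot0r hdot0l addr0 add0r.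
Qed.

Lemma blk22_dot x y : '[blk22 U x, y] = '[x, blk22 (uinv U) y].
Proof.
by have := uni_adj U (0, x) (0, y); rewrite !hdot_pairE /= hdot0r hdot0l !add0r.
Qed.

Lemma adj_blk11 y : adj (blk11 U) y = blk11 (uinv U) y.
Proof. by apply: adjE => v; exact: blk11_dot. Qed.

Lemma adj_blk12 y : adj (blk12 U) y = blk21 (uinv U) y.
Proof. by apply: adjE => v; exact: blk12_dot. Qed.

Lemma adj_blk21 y : adj (blk21 U) y = blk12 (uinv U) y.
Proof. by apply: adjE => v; exact: blk21_dot. Qed.
End Blocks.

(** Two families with the same Gram matrix, the first of them total, are related
    by an isometry. Its graph is the closed span G of the pairs (v_i, w_i). If T
    is an isometry, the orthogonal projection of (x, 0) onto its graph is
    (x / 2, T x / 2), and that of (0, y) is (T^* y / 2, T T^* y / 2). So one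
    projection onto G shows that the graph is total, and another one produces
    the projection of y onto the range, with no completeness argument. *)
Section IsometricExtension.
Variables (R : realType) (V W : hilbertType R) (I : Type) (v : I -> V) (w : I -> W).
Hypothesis gram : forall i j, '[v i, v j] = '[w i, w j].
Hypothesis total : forall x, (forall i, '[x, v i] = 0) -> x = 0.

Let G : closed_subspace (V * W)%type := cspan [set p | exists i, p = (v i, w i)]%classic.

Let G_gen i : G (v i, w i).
Proof. by apply: cspan_gen; exists i. Qed.

Let G_isom p q : G p -> G q -> '[p.1, q.1] = '[p.2, q.2].
Proof.
have dotE (a b : V * W) : '[a, (b.1, - b.2)] = 0 -> '[a.1, b.1] = '[a.2, b.2].
  by rewrite hdot_pairE /= -[- b.2]sub0r hdotBr hdot0r sub0r => /eqP; rewrite subr_eq0 => /eqP.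
have dotE' (a b : V * W) : '[a.1, b.1] = '[a.2, b.2] -> '[a, (b.1, - b.2)] = 0.
  by rewrite hdot_pairE /= -[- b.2]sub0r hdotBr hdot0r sub0r => ->; rewrite subrr.
move=> Gp Gq.
have h j : '[p.1, v j] = '[p.2, w j].
  apply: (dotE p (v j, w j)); apply: cspan_orth Gp => _ [i ->].
  by apply: (dotE' _ (v j, w j)) => /=.
rewrite hdotC [RHS]hdotC; congr Num.conj_op.
apply: dotE; apply: cspan_orth Gq => _ [i ->].
by apply: dotE' => /=; rewrite hdotC h -hdotC.
Qed.

Let G_total x : exists y, G (x, y).
Proof.
have [p [Gp hp]] := projection_exists G (x, 0).
have e : x = p.1 + p.1.
  apply/eqP; rewrite -subr_eq0; apply/eqP/total => i.
  have := hp _ (G_gen i); rewrite hdot_pairE /= sub0r -[- p.2]sub0r !hdotBl hdot0l.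
  by rewrite -(G_isom Gp (G_gen i)) /= sub0r hdotDl opprD addrA.
by exists (p.2 + p.2); rewrite e; have := cs_add Gp Gp; rewrite [X in G X]surjective_pairing.
Qed.

Lemma isometric_extension : exists T : V -> W,
  [/\ linear T, forall x y, '[T x, T y] = '[x, y], forall i, T (v i) = w i
    & forall y, exists x, forall z, '[y - T x, T z] = 0].
Proof.
have [T hT] := choice G_total.
have uniq x y : G (x, y) -> y = T x.
  move=> h; have h0 := cs_sub h (hT x).
  apply/eqP; rewrite -subr_eq0; apply/eqP/hdot_eq0.
  by rewrite -(G_isom h0 h0) /= subrr hdot0l.
have Tl : linear T.
  by move=> a x y; apply/esym/uniq; have := cs_linear a (hT x) (hT y).
have Td x y : '[T x, T y] = '[x, y] by rewrite -(G_isom (hT x) (hT y)).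
exists T; split=> // [i|y]; first exact/esym/uniq.
have [p [Gp hp]] := projection_exists G (0, y).
have ep : p.2 = T p.1 by apply: uniq; rewrite -surjective_pairing.
exists (p.1 + p.1) => z; have := hp _ (hT z).
have /= e := G_isom Gp (hT z).
rewrite hdot_pairE /= hdotBl hdot0l e hdotBl => <-.
by rewrite hdotBl (linD Tl) -ep hdotDl; ring.
Qed.
End IsometricExtension.

(** * Geometric series of operators *)

Section Geometric.
Variables (R : realType) (d : nat) (H : hilbertType R).
Implicit Types (M f : 'I_d -> H -> H) (n : multiindex d) (x : H).

Definition absdeg n : nat := (\sum_k absz (n k))%N.

(** Each factor z_k M_k raises the degree by one, so that the power j contributes
    in degree j only; this makes the truncation in [geom] harmless. *)
Lemma geom_pow_supp M : (forall k, linear (M k)) -> forall j n x,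
  absdeg n != j -> geom_pow M j n x = 0.
Proof.
move=> Ml j n x nj.
suff supp i m : geom_pow M i m x != 0 -> mnonneg m && (\sum_k m k == i%:Z).
  apply/eqP/negPn/negP => /supp/andP[/forallP n0 /eqP e]; case/eqP: nj.
  suff [] : (absdeg n)%:Z = j by [].
  rewrite -e /absdeg (big_morph Posz PoszD (erefl _)); apply: eq_bigr => k _.
  by rewrite gez0_abs ?n0.
elim: i m {n nj} => [|{}j IH] n /=.
  have [->|] := eqVneq n 0; last by rewrite eqxx.
  move=> _; rewrite big1 => [|k _]; last by rewrite ffunE.
  by rewrite eqxx andbT; apply/forallP => k; rewrite ffunE.
have [[k nk]|h] := pselect (exists k, geom_pow M j (n - evec k) x != 0); last first.
  rewrite big1 ?eqxx // => k _; have [->|nk] := eqVneq (geom_pow M j (n - evec k) x) 0.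
    by rewrite (lin0 (Ml k)).
  by case: h; exists k.
move=> _; have /andP[/forallP n0 /eqP ns] := IH _ nk.
apply/andP; split.
  apply/forallP => i; have := n0 i; rewrite !ffunE subr_ge0.
  by apply: le_trans; case: (i == k).
have e : \sum_i (n - evec k) i = \sum_i n i - 1.
  transitivity (\sum_i (n i - (i == k)%:Z)); first by apply: eq_bigr => i _; rewrite !ffunE.
  by rewrite sumrB [X in _ - X](bigD1 k) //= eqxx [X in _ - (_ + X)]big1 ?addr0 // => i /negPf->.
by move/eqP: ns; rewrite e subr_eq -PoszD addn1.
Qed.

Lemma geom_trunc M : (forall k, linear (M k)) -> forall N n x, (absdeg n < N)%N ->
  geom M n x = \sum_(j < N) geom_pow M j n x.
Proof.
move=> Ml N n x nN; rewrite /geom (big_ord_widen N (fun j => geom_pow M j n x)) //.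
rewrite big_mkcond; apply: eq_bigr => j _; case: ifP => // h.
by rewrite geom_pow_supp // neq_ltn; apply/orP; left; rewrite ltnNge -ltnS h.
Qed.

Lemma geom_rec M : (forall k, linear (M k)) -> forall n x,
  geom M n x = (if n == 0 then x else 0) + \sum_k M k (geom M (n - evec k) x).
Proof.
move=> Ml n x; pose N := (absdeg n + \sum_k absdeg (n - evec k)%R)%N.+1.
have hN k : (absdeg (n - evec k)%R < N)%N.
  by rewrite ltnS (bigD1 k) //= addnCA leq_addr.
rewrite (@geom_trunc _ Ml N.+1) ?ltnS; last by rewrite ltnW // ltnS leq_addr.
rewrite big_ord_recl /= exchange_big; congr (_ + _); apply: eq_bigr => k _.
by rewrite (geom_trunc Ml _ (hN k)) (lin_sum (Ml k)).
Qed.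

Lemma geom_pow_recr M : (forall k, linear (M k)) -> forall j n x,
  geom_pow M j.+1 n x = \sum_k geom_pow M j (n - evec k) (M k x).
Proof.
move=> Ml; elim=> [|j IH] n x.
  by apply: eq_bigr => k _ /=; case: ifP => // _; rewrite (lin0 (Ml k)).
rewrite [LHS](_ : _ = \sum_k M k (geom_pow M j.+1 (n - evec k) x)) //.
under eq_bigr => k do rewrite IH (lin_sum (Ml k)).
rewrite exchange_big; apply: eq_bigr => k _ /=; apply: eq_bigr => l _.
by rewrite addrAC.
Qed.

Lemma geom_adj M M' : (forall k, linear (M k)) -> (forall k, linear (M' k)) ->
  (forall k x y, '[M k x, y] = '[x, M' k y]) ->
  forall n x y, '[geom M n x, y] = '[x, geom M' n y].
Proof.
move=> Ml Ml' h n x y; rewrite /geom hdot_suml hdot_sumr; apply: eq_bigr => j _.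
move: (nat_of_ord j) => {}j; elim: j n x y => [|j IH] n x y.
  by rewrite /=; case: ifP => //; rewrite hdot0l hdot0r.
rewrite geom_pow_recr // hdot_suml /= hdot_sumr; apply: eq_bigr => k _.
by rewrite IH h.
Qed.

(** The identity (I - f A)^-1 f = f (I - A f)^-1, for f = z_1 f_1 + ... + z_d f_d:
    both sides are the sum of the words f, f A f, f A f A f, ... *)
Lemma geom_swap f (A : H -> H) : linear A -> (forall k, linear (f k)) -> forall n x,
  \sum_k geom (fun k => f k \o A) (n - evec k) (f k x)
  = \sum_k f k (geom (fun k => A \o f k) (n - evec k) x).
Proof.
move=> Al fl n x.
have l1 k : linear (f k \o A) by move=> a u v /=; rewrite Al fl.
have l2 k : linear (A \o f k) by move=> a u v /=; rewrite fl Al.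
pose N := (\sum_k absdeg (n - evec k)%R)%N.+1.
have hN k : (absdeg (n - evec k)%R < N)%N by rewrite ltnS (bigD1 k) //= leq_addr.
under eq_bigr => k do rewrite (geom_trunc l1 _ (hN k)).
under [RHS]eq_bigr => k do rewrite (geom_trunc l2 _ (hN k)) (lin_sum (fl k)).
rewrite exchange_big [RHS]exchange_big; apply: eq_bigr => j _ /=.
move: (nat_of_ord j) => {N hN}j; elim: j n => [|j IH] n.
  by apply: eq_bigr => k _ /=; case: ifP => //; rewrite (lin0 (fl k)).
rewrite exchange_big /=; apply: eq_bigr => k _.
under eq_bigr => l do rewrite addrAC.
by rewrite -(lin_sum (fl k)) -(lin_sum Al) IH (lin_sum Al).
Qed.
End Geometric.

(** * The defect spaces of V *)

Section Model.
Variables (R : realType) (d : nat) (E Es : hilbertType R).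
Variables (S : multiindex d -> E -> Es) (K : 'I_d -> kernel d (Es * E)%type).
Hypothesis K_dec : augmented_agler S K.
Variables (HK : forall k, rkhs (K k)) (HK' : forall k, rkhs (shift_kernel k (K k))).

(** The square norm of this vector is <K_k(0,0) (0, e), (0, e)>, and the second
    row of the factor H_k vanishes at index 0, as -e_k has a negative entry. *)
Lemma rk_kern_00 k e : rk_kern (HK k) 0 (0, e) = 0.
Proof.
have [_ [X [H1 [H2 [_ _ H2supp KE]]]]] := K_dec.1 k.
apply: hdot_eq0; rewrite rk_reproducing rk_kernE KE hdot_pairE /= hdot0r add0r.
rewrite H2supp ?hdot0l // add0r; apply/negP => /forallP /(_ k).
by rewrite !ffunE eqxx.
Qed.

(** Testing against the generator of index 0 kills the component in E, as its
    part in the spaces H(K_k) vanishes; testing against the others then says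
    that the coefficients of the sum of the series are zero. *)
Lemma Vdom_orth (x : dsum HK * E) :
  (forall y : Vdom S HK, '[x, cs_val y] = 0) ->
  exists l : overlapping HK, x = (cs_val l, 0).
Proof.
move=> h.
have g m es e : '[x, gen_dom S HK m es e] = 0.
  have Dg : Vdom S HK (gen_dom S HK m es e) by apply: cspan_gen; exists m, es, e.
  exact: (h (cs_elt Dg)).
have x20 : x.2 = 0.
  apply: hdot_eq0; have := g 0 0 x.2; rewrite hdot_pairE /= eqxx adj0 add0r.
  by rewrite hdot_dsumE big1 ?add0r // => k _; rewrite rk_kern_00 hdot0r.
have Lx : overlapping HK x.1.
  move=> n; apply: hdot_ext => -[es e]; rewrite hdot0l hdot_suml.
  rewrite -[RHS](g n es e) hdot_pairE x20 hdot0l addr0 hdot_dsumE.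
  by apply: eq_bigr => k _; rewrite rk_reproducing.
by exists (cs_elt Lx); rewrite [LHS]surjective_pairing x20.
Qed.

Lemma Vdom_split (x : dsum HK * E) :
  exists (y : Vdom S HK) (l : overlapping HK), x = cs_val y + (cs_val l, 0).
Proof.
have [p [Dp hp]] := projection_exists (Vdom S HK) x.
have [l el] : exists l : overlapping HK, x - p = (cs_val l, 0).
  by apply: Vdom_orth => y; apply: hp; exact: cs_valK.
by exists (cs_elt Dp), l; rewrite -el /= addrC subrK.
Qed.

Variables (V : unitary (Vdom S HK) (Vran S HK)).
Variables (U0 : unitary (dsum HK * E * overlapping HK')%type
                        (dsum HK * Es * overlapping HK)%type).
Hypothesis U0P : is_U0 V U0.
Local Notation L := (overlapping HK).
Local Notation L' := (overlapping HK').
Local Notation J l' := (jmap HK (cs_val l')).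

Lemma U0E (y : Vdom S HK) (l : L) (l' : L') :
  U0 (cs_val y + (cs_val l, 0), l') = (cs_val (V y) + (J l', 0), l).
Proof.
have [hV hL hL'] := U0P.
have -> : (cs_val y + (cs_val l, 0), l') = (cs_val y, 0) + (cs_val l, 0, 0) + (0, 0, l').
  by rewrite [RHS]surjective_pairing /= !addr0 !add0r.
rewrite !(linD (uni_lin U0)) hV hL hL' [LHS]surjective_pairing /=.
by rewrite addr0 add0r addr0.
Qed.

Lemma U0_L (l : L) (l' : L') : U0 (cs_val l, 0, l') = (J l', 0, l).
Proof.
have := U0E 0 l l'; rewrite (lin0 (uni_lin V)) !cs_val0 !add0r; exact.
Qed.

Lemma J_lin : linear (fun l' : L' => J l').
Proof.
have [_ _ hL'] := U0P; move=> a x y.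
have := uni_lin U0 a (0, 0, x) (0, 0, y); rewrite !hL'.
have -> : a *: (0, 0, x) + (0, 0, y) = (0, 0, a *: x + y) :> dsum HK * E * L'.
  by rewrite !pair_scaleE !pair_addE !scaler0 !addr0.
by rewrite hL' => -[].
Qed.

Lemma J_dot (x y : L') : '[J x, J y] = '[x, y].
Proof.
have [_ _ hL'] := U0P.
have := uni_dot U0 (0, 0, x) (0, 0, y); rewrite !hL' !hdot_pairE /=.
by rewrite !hdot0l !add0r !addr0.
Qed.

Lemma J_inj (x y : L') : J x = J y -> x = y.
Proof. exact: (@isometry_inj _ _ _ (fun l' : L' => J l') J_lin J_dot). Qed.

(** The complement of R is read off from the unitary U0: a vector orthogonal to R
    has a preimage that is orthogonal to D and to L, hence lies in L'. *)
Lemma Vran_orth (z : dsum HK * Es) :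
  (forall y : Vdom S HK, '[z, cs_val (V y)] = 0) ->
  exists l' : L', z = (J l', 0).
Proof.
have [hV hL hL'] := U0P; move=> h; pose q := uinv U0 (z, 0).
have Uq : U0 q = (z, 0) by rewrite /q uinvK.
have [|l el] := @Vdom_orth q.1.
  move=> y; have := uni_dot U0 q (cs_val y, 0).
  by rewrite Uq hV !hdot_pairE /= -hdot_pairE h hdot0r hdot0r !addr0 => <-.
have l0 : l = 0.
  apply: hdot_eq0; have := uni_dot U0 q (cs_val l, 0, 0).
  rewrite Uq hL [q]surjective_pairing el !hdot_pairE /= !hdot0r !hdot0l !addr0.
  by rewrite -hdot_csE.
exists q.2; have := Uq; rewrite [q]surjective_pairing el l0 cs_val0 hL'.
by case.
Qed.

(** * The feedback connection *)

Section Extension.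
Variable Ht : 'I_d -> hilbertType R.
Implicit Types (Ut : load HK HK' Ht) (U : extension HK Ht).

(** The solution of the loop: the signal l is the third component of U0 (h, e, 0),
    as it does not depend on l'. *)
Definition closed_loop Ut (x : dsum HK * dsum Ht * E) : dsum HK * dsum Ht * Es :=
  let y := Ut (x.1.2, (U0 (x.1.1, x.2, 0)).2) in
  let z := U0 (x.1.1, x.2, y.2) in (z.1.1, y.1, z.1.2).

Lemma U0_snd h e (l' : L') : (U0 (h, e, l')).2 = (U0 (h, e, 0)).2.
Proof. by have [y [l ->]] := Vdom_split (h, e); rewrite !U0E. Qed.

Definition loop Ut (x : dsum HK * dsum Ht * E) (y : dsum HK * dsum Ht * Es)
    (l : L) (l' : L') : Prop :=
  U0 (x.1.1, x.2, l') = (y.1.1, y.2, l) /\ Ut (x.1.2, l) = (y.1.2, l').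

Lemma loopP Ut x y l l' :
  loop Ut x y l l' <->
  [/\ l = (U0 (x.1.1, x.2, 0)).2, l' = (Ut (x.1.2, l)).2 & closed_loop Ut x = y].
Proof.
case: x y => -[h ht] e [[h' ht'] es]; rewrite /loop /closed_loop /=.
split=> [[e1 e2]|[-> ->]].
  have <- : l = (U0 (h, e, 0)).2 by rewrite -(U0_snd _ _ l') e1.
  by rewrite e2 /= e1.
move=> [<- <- <-]; split; last exact: surjective_pairing.
by rewrite [LHS]surjective_pairing [X in (_, X) = _]U0_snd [X in (X, _) = _]surjective_pairing.
Qed.

Lemma closed_loop_loop Ut x : exists l l', loop Ut x (closed_loop Ut x) l l'.
Proof. by eexists; eexists; apply/loopP; split. Qed.

(** The signals in a loop are unique, so the feedback relation is the graph of
    the closed loop. *)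
Lemma feedbackP Ut U : feedback U0 Ut U <-> forall x, U x = closed_loop Ut x.
Proof.
have uniq x : exists! ll : L * L', loop Ut x (closed_loop Ut x) ll.1 ll.2.
  have [l [l' h]] := closed_loop_loop Ut x; exists (l, l'); split=> // -[l2 l2'] /= h2.
  by have [-> -> _] := (loopP _ _ _ _ _).1 h; have [-> -> _] := (loopP _ _ _ _ _).1 h2.
split=> [fb [[h ht] e]|UE h ht e h' ht' es].
  set y := closed_loop _ _; rewrite [y]surjective_pairing [y.1]surjective_pairing.
  by apply/fb; exact: (uniq (h, ht, e)).
rewrite UE; split=> [eU|[[l l'] [lp _]]].
  by have := uniq (h, ht, e); rewrite eU.
by have [] := (loopP Ut (h, ht, e) (h', ht', es) l l').1 lp.
Qed.

Lemma closed_loop_V Ut (y : Vdom S HK) :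
  closed_loop Ut ((cs_val y).1, 0, (cs_val y).2) = ((cs_val (V y)).1, 0, (cs_val (V y)).2).
Proof.
have [hV _ _] := U0P.
rewrite /closed_loop /= -surjective_pairing hV /=.
by rewrite (lin0 (uni_lin Ut)) /= hV.
Qed.

Lemma closed_loop_L Ut ht (l : L) :
  closed_loop Ut (cs_val l, ht, 0) = (J (Ut (ht, l)).2, (Ut (ht, l)).1, 0).
Proof. by rewrite /closed_loop /= !U0_L. Qed.

(** In the sum of the isometry relations of U0 and Ut the inner products of the
    internal signals l and l' occur on both sides and cancel. *)
Lemma closed_loop_is_unitary Ut : Defs.is_unitary (closed_loop Ut).
Proof.
split.
- move=> a x y; have [l [l' [hx1 hx2]]] := closed_loop_loop Ut x.
  have [k [k' [hy1 hy2]]] := closed_loop_loop Ut y.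
  have /loopP[_ _ ->//] : loop Ut (a *: x + y)
    (a *: closed_loop Ut x + closed_loop Ut y) (a *: l + k) (a *: l' + k').
  split.
    by have := uni_lin U0 a (x.1.1, x.2, l') (y.1.1, y.2, k'); rewrite hx1 hy1.
  by have := uni_lin Ut a (x.1.2, l) (y.1.2, k); rewrite hx2 hy2.
- move=> x y; have [l [l' [hx1 hx2]]] := closed_loop_loop Ut x.
  have [k [k' [hy1 hy2]]] := closed_loop_loop Ut y.
  have := uni_dot U0 (x.1.1, x.2, l') (y.1.1, y.2, k').
  have := uni_dot Ut (x.1.2, l) (y.1.2, k).
  rewrite hx1 hy1 hx2 hy2 !hdot_pairE /= => e1 e2.
  have combine (a b c a' b' c' p q : R[i]%C) :
      c + p = c' + q -> a + b + q = a' + b' + p -> a + c + b = a' + c' + b'.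
    move=> e3 e4; apply/eqP; rewrite -subr_eq0.
    have -> : a + c + b - (a' + c' + b') =
      (c + p - (c' + q)) + (a + b + q - (a' + b' + p)) by ring.
    by rewrite e3 e4 !subrr addr0.
  exact: combine e1 e2.
- move=> [[h' ht'] es].
  (* The reversed loop is solvable for the same reason: the component in L' of
     the inverse of U0 does not depend on the signal l. *)
  pose l' := (uinv U0 (h', es, 0)).2; pose y := uinv Ut (ht', l').
  pose x := uinv U0 (h', es, y.2).
  have ex : x.2 = l'.
    have [_ hL _] := U0P.
    have : uinv U0 (0, 0, y.2) = (cs_val y.2, 0, 0) by rewrite -hL uniK.
    have -> : (0, 0, y.2) = (h', es, y.2) - (h', es, 0) :> dsum HK * Es * L.
      by rewrite [RHS]surjective_pairing /= !subrr subr0.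
    rewrite (linB (uni_lin _)) => /(congr1 snd) /= /eqP.
    by rewrite subr_eq0 => /eqP.
  exists (x.1.1, y.1, x.1.2).
  have /loopP[_ _ ->//] : loop Ut (x.1.1, y.1, x.1.2) (h', ht', es) y.2 l'.
  split=> /=; last by rewrite -surjective_pairing /y uinvK.
  by rewrite -ex -!surjective_pairing /x uinvK.
Qed.

Definition closed_loop_unitary Ut : extension HK Ht := Unitary (closed_loop_is_unitary Ut).

Lemma closed_loop_matrix Ut x : closed_loop Ut x = feedback_matrix U0 Ut x.
Proof.
case: x => -[h ht] e; rewrite /feedback_matrix /closed_loop /=.
have U0_add (l' : L') : U0 (h, e, l') = U0 (h, 0, 0) + U0 (0, e, 0) + U0 (0, 0, l').
  rewrite -!(linD (uni_lin U0)); congr (U0 _).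
  by rewrite !pair_addE !addr0 !add0r.
have U0_3D a b : U0 (0, 0, a + b) = U0 (0, 0, a) + U0 (0, 0, b).
  rewrite -(linD (uni_lin U0)); congr (U0 _).
  by rewrite !pair_addE !addr0.
have Ut_add l1 l2 : Ut (ht, l1 + l2) = Ut (ht, 0) + Ut (0, l1) + Ut (0, l2).
  rewrite -!(linD (uni_lin Ut)); congr (Ut _).
  by rewrite !pair_addE !addr0 !add0r.
rewrite !U0_add (lin0 (uni_lin U0)) addr0 /= Ut_add /= !U0_3D /=.
rewrite /tblk11 /tblk12 /tblk13 /tblk21 /tblk22 /tblk23 /tblk31 /tblk32.
rewrite /blk11 /blk12 /blk21 /blk22.
have regroup (G : zmodType) (a b c1 c2 c3 : G) :
    a + b + (c1 + c2 + c3) = a + c2 + c1 + (b + c3).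
  by rewrite addrACA [c1 + c2]addrC [a + (_ + _)]addrA.
by rewrite !regroup [(Ut (ht, 0)).1 + _]addrC.
Qed.

(** D (+) 0 and L (+) T span the whole space, so the behaviour on these two
    subspaces determines the extension. *)
Lemma extends_feedback Ut U :
  feedback U0 Ut U <-> extends_V V U /\
    (forall ht l, U (cs_val l, ht, 0) = (J (Ut (ht, l)).2, (Ut (ht, l)).1, 0)).
Proof.
split=> [/feedbackP UE|[UV UL]].
  by split=> [y|ht l]; rewrite UE ?closed_loop_V ?closed_loop_L.
apply/feedbackP => -[[h ht] e]; have [y [l el]] := Vdom_split (h, e).
have eh : h = (cs_val y).1 + cs_val l := congr1 fst el.
have ee : e = (cs_val y).2 by have := congr1 snd el; rewrite /= addr0.
have -> : (h, ht, e) = ((cs_val y).1, 0, (cs_val y).2) + (cs_val l, ht, 0).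
  by rewrite !pair_addE -eh add0r addr0 ee.
have [cl _ _] := closed_loop_is_unitary Ut.
by rewrite (linD cl) (linD (uni_lin U)) closed_loop_V closed_loop_L UL UV.
Qed.

Lemma feedback_load_uniq Ut Ut' U : feedback U0 Ut U -> feedback U0 Ut' U -> Ut = Ut'.
Proof.
move=> /extends_feedback[_ h] /extends_feedback[_ h']; apply: uni_ext => -[ht l].
have := h ht l; rewrite h' => -[/J_inj e1 e2].
by rewrite [LHS]surjective_pairing [RHS]surjective_pairing e1 e2.
Qed.

(** U maps L (+) T, the complement of D, onto J L' (+) T, the complement of R. *)
Lemma extension_load U : extends_V V U -> exists Ut, feedback U0 Ut U.
Proof.
move=> UV.
have perp1 ht (l : L) (y : Vdom S HK) :
    '[(cs_val l, ht, 0) : dsum HK * dsum Ht * E, ((cs_val y).1, 0, (cs_val y).2)] = 0.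
  have [hV hL _] := U0P; have := uni_dot U0 (cs_val l, 0, 0) (cs_val y, 0).
  by rewrite hL hV !hdot_pairE /= !hdot0l !hdot0r !addr0 => <-.
have perp2 ht (l' : L') (y : Vdom S HK) :
    '[(J l', ht, 0) : dsum HK * dsum Ht * Es, ((cs_val (V y)).1, 0, (cs_val (V y)).2)] = 0.
  have [hV _ hL'] := U0P; have := uni_dot U0 (0, 0, l') (cs_val y, 0).
  by rewrite hL' hV !hdot_pairE /= !hdot0l !hdot0r !addr0 => ->.
have : forall p : dsum Ht * L, exists q : dsum Ht * L',
    U (cs_val p.2, p.1, 0) = (J q.2, q.1, 0).
  move=> [ht l] /=; set z := U _.
  have [|l' el'] := @Vran_orth (z.1.1, z.2).
    move=> y; rewrite -(perp1 ht l y) -(uni_dot U) UV -/z !hdot_pairE /=.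
    by rewrite hdot0r addr0.
  exists (z.1.2, l') => /=.
  by rewrite [z]surjective_pairing [z.1]surjective_pairing; case: el' => -> ->.
move=> /choice[W WE].
have Wuniq p q : U (cs_val p.2, p.1, 0) = (J q.2, q.1, 0) -> q = W p.
  by rewrite WE => -[/J_inj e1 e2]; rewrite [LHS]surjective_pairing -e1 -e2 -surjective_pairing.
have Wu : Defs.is_unitary W.
  split.
  - move=> a x y; apply/esym/Wuniq.
    have -> : (cs_val (a *: x + y).2, (a *: x + y).1, 0) =
        a *: (cs_val x.2, x.1, 0) + (cs_val y.2, y.1, 0) :> dsum HK * dsum Ht * E.
      by rewrite !pair_scaleE !pair_addE scaler0 addr0 -cs_valZ -cs_valD.
    rewrite uni_lin !WE !pair_scaleE !pair_addE scaler0 addr0.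
    by congr (_, _, _); have := J_lin a (W x).2 (W y).2.
  - move=> x y; have := uni_dot U (cs_val x.2, x.1, 0) (cs_val y.2, y.1, 0).
    rewrite !WE !hdot_pairE /= !hdot0l !addr0 J_dot hdot_csE => e.
    by rewrite addrC e addrC.
  - move=> [ht' l']; have [z ez] := uni_surj U (J l', ht', 0).
    have [|l el] := @Vdom_orth (z.1.1, z.2).
      move=> y; rewrite -(perp2 ht' l' y) -UV -ez uni_dot !hdot_pairE /=.
      by rewrite hdot0r addr0.
    exists (z.1.2, l); apply/esym/Wuniq => /=.
    rewrite -ez; congr (U _); rewrite [RHS]surjective_pairing [z.1]surjective_pairing.
    by case: el => -> ->.
exists (Unitary Wu); apply/extends_feedback; split=> // ht l; exact: (WE (ht, l)).
Qed.

End Extension.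

(** * Reducing subspaces and equivalences *)

(** The load is the restriction of the extension to L (+) T, read through J. *)
Lemma feedback_L (Ht : 'I_d -> hilbertType R) (Ut : load HK HK' Ht) U ht ht' (l : L) (l' : L') :
  feedback U0 Ut U ->
  Ut (ht, l) = (ht', l') <-> U (cs_val l, ht, 0) = (J l', ht', 0).
Proof.
move=> /extends_feedback[_ UL]; rewrite UL; split=> [->//|[/J_inj <- <-]].
exact: surjective_pairing.
Qed.

Lemma feedback_0 (Ht : 'I_d -> hilbertType R) (Ut : load HK HK' Ht) U ht ht' :
  feedback U0 Ut U -> Ut (ht, 0) = (ht', 0) <-> U (0, ht, 0) = (0, ht', 0).
Proof.
move=> /(feedback_L ht ht' 0 0); rewrite cs_val0.
by have -> : J (0 : L') = 0 by exact: (lin0 J_lin).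
Qed.

Section Connected.
Variable Ht : 'I_d -> hilbertType R.
Variables (Ut : load HK HK' Ht) (U : extension HK Ht).
Hypothesis fb : feedback U0 Ut U.

(** If Ut maps a subspace of T onto itself, with no signal in or out, then the
    orthogonal complement of that subspace contains the ranges of B and C^* and is
    invariant, hence is everything. *)
Lemma connected_no_reducing (M : closed_subspace (state (dsum2_colligation U))) :
  closely_connected (dsum_colligation Ut) ->
  reducing M -> (forall x, M x -> x.1 = 0) ->
  (forall k x, M x -> M (proj (dsum2_colligation U) k x)) ->
  forall x, M x -> x = 0.
Proof.
move=> cc red M1 MP.
pose N : set (dsum Ht) := [set x | M (0, x)]%classic.
have fwd x : N x -> exists2 x', N x' & Ut (x, 0) = (x', 0).
  move=> Tx; have : ([set opU (dsum2_colligation U) (x, 0) | x in [set x | M x]]%classic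
    (U (0, x, 0))) by exists (0, x).
  rewrite red => -[[y1 y2] /= My e]; have /= y10 := M1 _ My.
  by rewrite y10 in My e; exists y2 => //; apply/(feedback_0 x y2 fb).
have bwd x : N x -> exists2 x', N x' & uinv Ut (x, 0) = (x', 0).
  move=> Tx; have : ([set (y, 0) | y in [set y | M y]]%classic
    ((0, x, 0) : dsum HK * dsum Ht * Es)) by exists (0, x).
  rewrite -red => -[[y1 y2] /= My e]; have /= y10 := M1 _ My.
  rewrite y10 in My e; exists y2 => //.
  have e' : Ut (y2, 0) = (x, 0) by apply/(feedback_0 y2 x fb).
  by rewrite -e' uniK.
have dot1 (F : hilbertType R) (p : dsum Ht * F) x : '[p.1, x] = '[p, (x, 0)].
  by rewrite hdot_pairE hdot0r addr0.
have full : forall x, orth N x.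
  apply: cc => [l|l'|x Nx|x Nx|k x Nx] y Ty.
  - have [y' Ty' e] := bwd y Ty.
    by rewrite /opB /blk12 dot1 uni_adj e hdot_pairE /= hdot0l hdot0r addr0.
  - have [y' Ty' e] := fwd y Ty; rewrite /opC adj_blk21 /blk12 dot1.
    by rewrite hdotC -uni_adj e hdot_pairE /= hdot0l hdot0r addr0 conjC0.
  - have [y' Ty' e] := bwd y Ty.
    by rewrite /opA /blk11 dot1 uni_adj e hdot_pairE /= hdot0l addr0 Nx.
  - have [y' Ty' e] := fwd y Ty; rewrite /opA adj_blk11 /blk11 dot1.
    by rewrite hdotC -uni_adj e hdot_pairE /= hdot0r addr0 -hdotC Nx.
  - have [_ sa _ _] := dsum_proj_decomposition Ht.
    rewrite /= sa; apply: Nx; have := MP k _ Ty; rewrite /= /dsum2_proj /=.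
    by have [pl _ _ _] := dsum_proj_decomposition (fun k => HK k); rewrite (lin0 (pl k)).
move=> [x1 x2] Mx; have /= x10 := M1 _ Mx; rewrite x10 in Mx *.
by rewrite (hdot_eq0 (full x2 x2 Mx)).
Qed.

(** The complement of a subspace that violates closed connectedness is mapped by Ut
    onto itself without signals, hence is reducing for U. *)
Lemma no_reducing_connected :
  ~ (exists M : closed_subspace (state (dsum2_colligation U)),
       [/\ exists x, M x /\ x <> 0,
           reducing M,
           forall x, M x -> x.1 = 0
         & forall k x, M x -> M (proj (dsum2_colligation U) k x)]) ->
  closely_connected (dsum_colligation Ut).
Proof.
move=> noM N NB NC NA NA' NP; apply: closed_full => x Nx.
apply: contrapT => x0; apply: noM.
pose M : closed_subspace (dsum HK * dsum Ht)%type := orth [set q | N q.2]%classic.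
have MP1 p : M p -> p.1 = 0 /\ (forall n, N n -> '[p.2, n] = 0).
  move=> Mp; split.
    apply: hdot_eq0; rewrite -(Mp (p.1, 0)) ?hdot_pairE /= ?hdot0r ?addr0 //.
    exact: cs_zero.
  by move=> n Nn; rewrite -(Mp (0, n)) // hdot_pairE /= hdot0r add0r.
have MP2 y : (forall n, N n -> '[y, n] = 0) -> M (0, y).
  by move=> h q Nq; rewrite hdot_pairE /= hdot0l add0r h.
have dot2 (F F' : hilbertType R) (p : F * F') z : '[p.2, z] = '[p, (0, z)].
  by rewrite hdot_pairE hdot0r add0r.
have dot1 (F F' : hilbertType R) (p : F * F') z : '[p.1, z] = '[p, (z, 0)].
  by rewrite hdot_pairE hdot0r addr0.
have fwd y : (forall n, N n -> '[y, n] = 0) ->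
    exists2 y', (forall n, N n -> '[y', n] = 0) & U (0, y, 0) = (0, y', 0).
  move=> Ny; exists (Ut (y, 0)).1.
    move=> n Nn; rewrite dot1 uni_adj hdot_pairE /= hdot0l addr0.
    by rewrite Ny //; have := NA' n Nn; rewrite /opA adj_blk11.
  apply/(feedback_0 _ _ fb); rewrite [LHS]surjective_pairing; congr (_, _).
  apply: hdot_ext => z; rewrite hdot0l dot2 uni_adj hdot_pairE /= hdot0l addr0.
  by rewrite Ny //; have := NC z; rewrite /opC adj_blk21.
have bwd y : (forall n, N n -> '[y, n] = 0) ->
    exists2 y', (forall n, N n -> '[y', n] = 0) & U (0, y', 0) = (0, y, 0).
  move=> Ny; exists (uinv Ut (y, 0)).1.
    move=> n Nn; rewrite dot1 hdotC -uni_adj hdot_pairE /= hdot0r addr0.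
    by rewrite -hdotC Ny //; exact: NA.
  apply/(feedback_0 _ _ fb).
  have -> : ((uinv Ut (y, 0)).1, 0) = uinv Ut (y, 0); last exact: uinvK.
  rewrite [RHS]surjective_pairing; congr (_, _); apply/esym.
  apply: hdot_ext => z; rewrite hdot0l dot2 hdotC -uni_adj hdot_pairE /= hdot0r addr0.
  by rewrite -hdotC Ny //; exact: NB.
exists M; split.
- exists (0, x); split; first exact: MP2.
  by move=> [].
- apply/seteqP; split=> _ [[y1 y2] /= /MP1[/= -> Ny] <-].
    by have [y' Ny' ->] := fwd _ Ny; exists (0, y') => //; exact: MP2.
  by have [y' Ny' <-] := bwd _ Ny; exists (0, y') => //; exact: MP2.
- by move=> p /MP1[].
- move=> k [p1 p2] /MP1[/= -> Np]; rewrite /dsum2_proj /=.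
  have [pl _ _ _] := dsum_proj_decomposition (fun k => HK k); rewrite (lin0 (pl k)).
  apply: MP2 => n Nn; have [_ sa _ _] := dsum_proj_decomposition Ht.
  by rewrite sa; apply: Np; exact: NP.
Qed.
End Connected.

Section Equivalence.
Variables Ht Ht' : 'I_d -> hilbertType R.
Variables (Ut : load HK HK' Ht) (Ut' : load HK HK' Ht').
Variables (U : extension HK Ht) (U' : extension HK Ht').
Hypotheses (fb : feedback U0 Ut U) (fb' : feedback U0 Ut' U').

Lemma equivalent_loads :
  unitarily_equivalent (dsum_colligation Ut) (dsum_colligation Ut') ->
  exists tau : unitary (state (dsum2_colligation U)) (state (dsum2_colligation U')),
    intertwines tau /\ forall f : dsum HK, tau (f, 0) = (f, 0).
Proof.
move=> [sigma /= [sP sU]].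
pose tau (x : dsum HK * dsum Ht) : dsum HK * dsum Ht' := (x.1, sigma x.2).
have tu : Defs.is_unitary tau.
  split.
  - by move=> a x y; rewrite /tau /= uni_lin.
  - by move=> x y; rewrite !hdot_pairE /= uni_dot.
  - by move=> [x y]; have [z <-] := uni_surj sigma y; exists (x, z).
exists (Unitary tu); split; last first.
  by move=> f; rewrite /= /tau /= (lin0 (uni_lin sigma)).
split=> [k x|x e] /=; first by rewrite /tau /dsum2_proj /= sP.
have UE := (feedbackP Ut U).1 fb.
have UE' := (feedbackP Ut' U').1 fb'.
by rewrite UE UE' /closed_loop /= sU.
Qed.

(** Being unitary and the identity on X, tau preserves the complement T of X. *)
Lemma equivalent_extensions (tau : unitary (state (dsum2_colligation U))
    (state (dsum2_colligation U'))) :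
  intertwines tau -> (forall f : dsum HK, tau (f, 0) = (f, 0)) ->
  unitarily_equivalent (dsum_colligation Ut) (dsum_colligation Ut').
Proof.
move=> [/= tP tU] t0.
have tE f x : tau (f, x) = (f, (tau (0, x)).2).
  have z1 : (tau (0, x)).1 = 0.
    apply: hdot_ext => z; have := uni_dot tau (0, x) (z, 0).
    by rewrite t0 !hdot_pairE /= !hdot0l !hdot0r !addr0.
  have -> : (f, x) = (f, 0) + (0, x) by rewrite pair_addE addr0 add0r.
  by rewrite (linD (uni_lin tau)) t0 [tau (0, x)]surjective_pairing z1 pair_addE addr0 add0r.
pose sigma x := (tau (0, x)).2.
have su : Defs.is_unitary sigma.
  split.
  - move=> a x y; rewrite /sigma.
    have -> : (0, a *: x + y) = a *: (0, x) + (0, y) :> dsum HK * dsum Ht.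
      by rewrite pair_scaleE pair_addE scaler0 addr0.
    by rewrite uni_lin.
  - move=> x y; have := uni_dot tau (0, x) (0, y).
    by rewrite tE [tau (0, y)]tE !hdot_pairE /= !hdot0l !add0r.
  - move=> y; have [[f x] e] := uni_surj tau (0, y); exists x.
    by move: e; rewrite tE => -[].
exists (Unitary su); split=> [k x|x l] /=.
  have := tP k (0, x); rewrite tE [tau (_, _)]tE /dsum2_proj /=.
  have [pl _ _ _] := dsum_proj_decomposition (fun k => HK k); rewrite (lin0 (pl k)).
  by rewrite tE => -[].
apply/(feedback_L _ _ _ _ fb').
have /(feedback_L _ _ _ _ fb) e := surjective_pairing (Ut (x, l)).
have := tU (cs_val l, x) 0; rewrite /= e /= tE => ->.
by rewrite tE.
Qed.
End Equivalence.
End Model.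

(** * Compatible realizations *)

Lemma rkhs_total (R : realType) (d : nat) (G : hilbertType R) (K : kernel d G)
    (HK : rkhs K) (f : HK) :
  (forall m u, '[f, rk_kern HK m u] = 0) -> f = 0.
Proof.
move=> h; apply: (@rk_coef_inj _ _ _ _ HK); apply/funext => n.
rewrite (lin0 (@rk_coef_linear _ _ _ _ HK n)).
by apply: hdot_ext => u; rewrite hdot0l -rk_reproducing h.
Qed.

Section ColligationSeries.
Variables (R : realType) (d : nat) (E Es : hilbertType R) (c : colligation d E Es).
Implicit Types (n m : multiindex d) (k : 'I_d).

Local Notation H := (state c).
Local Notation P := (proj c).
Local Notation A := (opA c).
Local Notation B := (opB c).
Local Notation C := (opC c).
Local Notation D := (opD c).
Local Notation A' := (blk11 (uinv (opU c))).
Local Notation C' := (blk12 (uinv (opU c))).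
Local Notation B' := (blk21 (uinv (opU c))).
Local Notation D' := (blk22 (uinv (opU c))).

Lemma proj_lin k : linear (P k).
Proof. by have [h _ _ _] := proj_decomposition c; exact: h. Qed.

Lemma proj_sa k x y : '[P k x, y] = '[x, P k y].
Proof. by have [_ h _ _] := proj_decomposition c. Qed.

Lemma projK j k x : P j (P k x) = if j == k then P k x else 0.
Proof. by have [_ _ h _] := proj_decomposition c. Qed.

Lemma proj_sum x : \sum_k P k x = x.
Proof. by have [_ _ _ h] := proj_decomposition c. Qed.

Lemma right_factorE k m es e : right_factor c k m (es, e) =
  geom (fun j => A' \o P j) m (C' es) + geom (fun j => A \o P j) (- (m + evec k)) (B e) :> H.
Proof.
rewrite /right_factor /=; congr (_ + _); rewrite /opC adj_blk21; congr (geom _ _ _).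
by apply/funext => j; apply/funext => x /=; rewrite /opA adj_blk11.
Qed.

Let compl (f g : H -> H) : linear f -> linear g -> linear (f \o g).
Proof. by move=> fl gl a x y /=; rewrite gl fl. Qed.

Let A_lin : linear A. Proof. exact: blk11_lin (uni_lin _). Qed.
Let A'_lin : linear A'. Proof. exact: blk11_lin (uni_lin _). Qed.
Let C_lin : linear C. Proof. exact: blk21_lin (uni_lin _). Qed.
Let B'_lin : linear B'. Proof. exact: blk21_lin (uni_lin _). Qed.

Let PA_lin j : linear (P j \o A). Proof. exact: compl (@proj_lin j) A_lin. Qed.
Let AP_lin j : linear (A \o P j). Proof. exact: compl A_lin (@proj_lin j). Qed.
Let PA'_lin j : linear (P j \o A'). Proof. exact: compl (@proj_lin j) A'_lin. Qed.
Let A'P_lin j : linear (A' \o P j). Proof. exact: compl A'_lin (@proj_lin j). Qed.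

Lemma geom_PA_adj n x y :
  '[geom (fun j => P j \o A) n x, y] = '[x, geom (fun j => A' \o P j) n y].
Proof. by apply: geom_adj => // k {}x {}y /=; rewrite proj_sa blk11_dot. Qed.

Lemma geom_PA'_adj n x y :
  '[geom (fun j => P j \o A') n x, y] = '[x, geom (fun j => A \o P j) n y].
Proof. by apply: geom_adj => // k {}x {}y /=; rewrite proj_sa blk11_dot uinvE. Qed.

(** Taking adjoints reverses the words P_k A P_l A ... in the coefficients; this
    is what makes a compatible kernel the Gram matrix of vectors in the state
    space. *)
Lemma left_right_factor k n x v :
  '[left_factor k n x, v] = '[x, right_factor c k n v].
Proof.
case: v => es e; rewrite right_factorE hdotDr hdot_pairE /=; congr (_ + _).
  by rewrite blk21_dot geom_PA_adj.
rewrite /opB adj_blk12 blk21_dot uinvE -geom_PA'_adj; congr ('[geom _ _ _, _]).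
by apply/funext => j; apply/funext => y /=; rewrite /opA adj_blk11.
Qed.

Variable S : multiindex d -> E -> Es.
Hypothesis cS : realizes c S.

(** The coefficients of the series of Z(z) (I - A^* Z(z))^-1 C^* and of
    Z(z) (I - A Z(z))^-1 B, with Z(z) = z_1 P_1 + ... + z_d P_d. *)
Definition obs_series m es : H := \sum_k P k (geom (fun j => A' \o P j) (m - evec k) (C' es)).
Definition ctrl_series n e : H := \sum_k P k (geom (fun j => A \o P j) (n - evec k) (B e)).

(** First row: the recursion for (I - A Z)^-1 B. Second row: the realization
    formula of S. *)
Lemma ctrl_step n e : opU c (ctrl_series n e, if n == 0 then e else 0)
  = (geom (fun j => A \o P j) n (B e), S n e).
Proof.
rewrite (blkE (uni_lin _)); congr (_, _).
  rewrite [RHS](geom_rec AP_lin) addrC; congr (_ + _); last exact: lin_sum.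
  by case: ifP => // _; rewrite (lin0 (blk12_lin (uni_lin _))).
rewrite cS addrC; congr (_ + _).
  by case: ifP => // _; rewrite (lin0 (blk22_lin (uni_lin _))).
by rewrite -(lin_sum C_lin) geom_swap //; exact: proj_lin.
Qed.

(** The dual recursion, for the inverse colligation; its second row is the
    adjoint of the realization formula. *)
Lemma obs_step m es : opU c (geom (fun j => A' \o P j) m (C' es), adj (S m) es)
  = (obs_series m es, if m == 0 then es else 0).
Proof.
apply: (can_inj (uniK (uinv (opU c)))); rewrite uniK [RHS](blkE (uni_lin _)); congr (_, _).
  rewrite (geom_rec A'P_lin) addrC; congr (_ + _); first exact/esym/lin_sum.
  by case: ifP => // _; rewrite (lin0 (blk12_lin (uni_lin _))).
apply: adjE => v; have /(congr1 snd) /= <- := ctrl_step m v.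
rewrite (blkE (uni_lin _)) /= hdotDl hdotDr; congr (_ + _); last first.
  rewrite blk22_dot; case: ifP => // _.
  by rewrite hdot0l (lin0 (blk22_lin (uni_lin _))) hdot0r.
rewrite blk21_dot /ctrl_series /obs_series (lin_sum B'_lin) hdot_sumr.
have -> : \sum_k P k (geom (fun j => A \o P j) (m - evec k) (B v)) =
  \sum_k geom (fun j => P j \o A) (m - evec k) (P k (B v)).
  by rewrite geom_swap //; exact: proj_lin.
rewrite hdot_suml; apply: eq_bigr => k _.
by rewrite geom_PA_adj proj_sa blk12_dot.
Qed.

Lemma right_factor_sum m es e : \sum_k P k (right_factor c k m (es, e)) =
  geom (fun j => A' \o P j) m (C' es) + ctrl_series (- m) e :> H.
Proof.
under eq_bigr do rewrite right_factorE (linD (@proj_lin _)) opprD.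
by rewrite big_split /= proj_sum.
Qed.

Lemma right_factor_shift_sum m es e : \sum_k P k (right_factor c k (m - evec k) (es, e)) =
  obs_series m es + geom (fun j => A \o P j) (- m) (B e) :> H.
Proof.
under eq_bigr do rewrite right_factorE (linD (@proj_lin _)) subrK.
by rewrite big_split /= proj_sum.
Qed.

(** In the state space, this is the rule by which V maps the generators of D to
    those of R. *)
Lemma colligation_step m es e :
  opU c (\sum_k P k (right_factor c k m (es, e)), adj (S m) es + (if m == 0 then e else 0))
  = (\sum_k P k (right_factor c k (m - evec k) (es, e)),
     (if m == 0 then es else 0) + S (- m) e).
Proof.
rewrite right_factor_sum right_factor_shift_sum -pair_addE (linD (uni_lin _)).
by rewrite obs_step -oppr_eq0 ctrl_step pair_addE.
Qed.

Variable K : 'I_d -> kernel d (Es * E)%type.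
Hypothesis cK : compatible c K.
Variable HK : forall k, rkhs (K k).

(** Compatibility is the equality of the Gram matrices of [K_k]_m u and of
    P_k right_factor_m u; the kernel functions are total in H(K_k). *)
Lemma state_embedding k : exists G : HK k -> H,
  [/\ linear G, forall x y, '[G x, G y] = '[x, y],
      forall m u, G (rk_kern (HK k) m u) = P k (right_factor c k m u),
      forall f, P k (G f) = G f
    & forall y, exists f, forall g, '[y - G f, G g] = 0].
Proof.
have [||G [Gl Gd Gk Gp]] := @isometric_extension _ (HK k) H (multiindex d * (Es * E))
    (fun p => rk_kern (HK k) p.1 p.2) (fun p => P k (right_factor c k p.1 p.2)).
- move=> [m u] [n v] /=.
  by rewrite rk_reproducing rk_kernE cK left_right_factor [RHS]proj_sa projK eqxx -proj_sa.
- by move=> f hf; apply: rkhs_total => m u; exact: (hf (m, u)).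
exists G; split=> // [m u|f]; first exact: (Gk (m, u)).
apply: hdot_ext => y; apply/eqP; rewrite proj_sa -subr_eq0 -hdotBr; apply/eqP.
have [x hx] := Gp (P k y - y).
have Gx z : '[G z, P k y - y] = '[z, x].
  by rewrite -Gd; apply/eqP; rewrite -subr_eq0 -hdotBr hdotC hx conjC0.
rewrite Gx (_ : x = 0) ?hdot0r //; apply: rkhs_total => n u.
by rewrite hdotC -Gx (Gk (n, u)) hdotBr -proj_sa projK eqxx subrr conjC0.
Qed.

End ColligationSeries.

Section Realization.
Variables (R : realType) (d : nat) (E Es : hilbertType R).
Variables (S : multiindex d -> E -> Es) (K : 'I_d -> kernel d (Es * E)%type).
Variables (HK : forall k, rkhs (K k)) (HK' : forall k, rkhs (shift_kernel k (K k))).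
Variables (V : unitary (Vdom S HK) (Vran S HK)) (VP : is_V V).
Variables (U0 : unitary (dsum HK * E * overlapping HK')%type
                        (dsum HK * Es * overlapping HK)%type).
Hypothesis U0P : is_U0 V U0.
Variable c : colligation d E Es.
Hypotheses (cS : realizes c S) (cK : compatible c K).
Local Notation P := (proj c).

Let G (k : 'I_d) : HK k -> state c := projT1 (cid (state_embedding cK HK k)).

Let GP k : [/\ linear (@G k), forall x y : HK k, '[G x, G y] = '[x, y],
  forall m u, G (rk_kern (HK k) m u) = P k (right_factor c k m u),
  forall f : HK k, P k (G f) = G f
  & forall y, exists f : HK k, forall g : HK k, '[y - G f, G g] = 0].
Proof. exact: projT2 (cid (state_embedding cK HK k)). Qed.

(** The complement of the image of H(K_k) in the range of P_k, which is the
    complement of the vectors y - P_k y. *)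
Definition rest_space k : closed_subspace (state c) :=
  orth [set z | (exists y, z = y - P k y) \/ (exists f : HK k, z = G f)]%classic.

Lemma rest_spaceP k x :
  rest_space k x <-> P k x = x /\ forall f : HK k, '[x, G f] = 0.
Proof.
split=> [h|[Px Gx] z [[y ->]|[f ->]]//]; last first.
  by rewrite hdotBr -proj_sa Px subrr.
split=> [|f]; last by apply: h; right; exists f.
apply: hdot_ext => y; apply/eqP; rewrite proj_sa eq_sym -subr_eq0 -hdotBr.
by apply/eqP/h; left; exists y.
Qed.

Let Ht k : hilbertType R := rest_space k.

(* The identification of X (+) T with the state space. *)
Let Theta (p : dsum HK * dsum Ht) : state c := \sum_k (G (p.1 k) + cs_val (p.2 k)).

Let Theta_proj j p : P j (Theta p) = G (p.1 j) + cs_val (p.2 j).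
Proof.
have fix_ k : P k (G (p.1 k) + cs_val (p.2 k)) = G (p.1 k) + cs_val (p.2 k).
  have [_ _ _ PG _] := GP k; have [Px _] := (rest_spaceP _ _).1 (cs_valK (p.2 k)).
  by rewrite (linD (@proj_lin _ _ _ _ c k)) PG Px.
rewrite /Theta (lin_sum (@proj_lin _ _ _ _ c j)) (bigD1 j) //= fix_ big1 ?addr0 // => k kj.
by rewrite -fix_ projK eq_sym (negPf kj).
Qed.

Let Theta_unitary : Defs.is_unitary Theta.
Proof.
split.
- move=> a x y; rewrite /Theta scaler_sumr -big_split; apply: eq_bigr => k _ /=.
  have [Gl _ _ _ _] := GP k.
  rewrite -[LHS]/(G (a *: x.1 k + y.1 k) + cs_val (a *: x.2 k + y.2 k)).
  by rewrite Gl cs_valD cs_valZ scalerDr addrACA.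
- move=> x y; rewrite -[Theta x in LHS](proj_sum (c := c)) hdot_suml hdot_pairE !hdot_dsumE.
  rewrite -big_split; apply: eq_bigr => k _ /=.
  rewrite -[P k _](_ : P k (P k (Theta x)) = _); last by rewrite projK eqxx.
  rewrite proj_sa !Theta_proj; have [_ Gd _ _ _] := GP k.
  have [_ ox] := (rest_spaceP _ _).1 (cs_valK (x.2 k)).
  have [_ oy] := (rest_spaceP _ _).1 (cs_valK (y.2 k)).
  by rewrite hdotDl !hdotDr Gd ox add0r (orthC (oy _)) addr0.
- move=> y.
  have ex k : exists p : HK k * Ht k, P k y = G p.1 + cs_val p.2.
    have [Gl _ _ PG Gp] := GP k; have [f hf] := Gp (P k y).
    have Wf : rest_space k (P k y - G f).
      by apply/rest_spaceP; split=> //; rewrite (linB (@proj_lin _ _ _ _ c k)) projK eqxx PG.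
    by exists (f, cs_elt Wf); rewrite /= addrC subrK.
  pose p k := projT1 (cid (ex k)).
  exists ((fun k => (p k).1) : dsum HK, (fun k => (p k).2) : dsum Ht).
  rewrite -[RHS](proj_sum (c := c)) /Theta; apply: eq_bigr => k _ /=.
  by rewrite (projT2 (cid (ex k))).
Qed.

Let W := Unitary Theta_unitary.

Let U_fun (x : dsum HK * dsum Ht * E) : dsum HK * dsum Ht * Es :=
  (uinv W (opU c (W x.1, x.2)).1, (opU c (W x.1, x.2)).2).

Let U_unitary : Defs.is_unitary U_fun.
Proof.
split.
- move=> a x y; rewrite /U_fun.
  have -> : (W (a *: x + y).1, (a *: x + y).2) = a *: (W x.1, x.2) + (W y.1, y.2).
    by congr (_, _); exact: (uni_lin W a x.1 y.1).
  rewrite (uni_lin (opU c)); congr (_, _).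
  exact: (uni_lin (uinv W) a (opU c (W x.1, x.2)).1 (opU c (W y.1, y.2)).1).
- move=> x y; rewrite hdot_pairE /U_fun [X in X + _](uni_dot (uinv W)).
  rewrite -[LHS]hdot_pairE (uni_dot (opU c)) hdot_pairE.
  by rewrite [X in X + _ = _](uni_dot W).
- move=> [y es]; have [[x e] ex] := uni_surj (opU c) (W y, es).
  exists (uinv W x, e).
  transitivity (uinv W (opU c (W (uinv W x), e)).1, (opU c (W (uinv W x), e)).2) => //.
  by rewrite uinvK ex uniK.
Qed.

Let U : extension HK Ht := Unitary U_unitary.

Let W_kern (F : 'I_d -> multiindex d) u :
  W ((fun k => rk_kern (HK k) (F k) u) : dsum HK, 0)
  = \sum_k P k (right_factor c k (F k) u).
Proof.
rewrite /W /= /Theta; apply: eq_bigr => k _ /=.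
rewrite -[LHS]/(G (rk_kern (HK k) (F k) u) + cs_val (0 : Ht k)).
by have [_ _ -> _ _] := GP k; rewrite cs_val0 addr0.
Qed.

(* V acts only on D, so U is compared on the closed span of the generators with
   the everywhere defined U0. *)
Let U_extends : extends_V V U.
Proof.
move=> x; have [hV _ _] := U0P.
have -> : cs_val (V x) = (U0 (cs_val x, 0)).1 by rewrite hV.
pose f z := U (z.1, 0, z.2).
pose g z : dsum HK * dsum Ht * Es := ((U0 (z, 0)).1.1, 0, (U0 (z, 0)).1.2).
suff: f (cs_val x) = g (cs_val x) by [].
apply: (@eq_on_cspan _ _ _ _ f g
  (fun w => ((uinv U w).1.1, (uinv U w).2))
  (fun w => (uinv U0 (w.1.1, w.2, 0)).1) _ _ _ _ (cs_valK x)).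
- move=> z w; transitivity '[(z.1, 0, z.2) : dsum HK * dsum Ht * E, uinv U w].
    exact: uni_adj.
  by move: (uinv U w) => v; rewrite !hdot_pairE /= hdot0l addr0.
- move=> z w; transitivity '[U0 (z, 0), (w.1.1, w.2, 0)].
    by rewrite !hdot_pairE /= hdot0l hdot0r !addr0.
  by rewrite uni_adj [LHS]hdot_pairE /= hdot0l addr0.
move=> _ [m [es [e ->]]].
have Dg : Vdom S HK (gen_dom S HK m es e) by apply: cspan_gen; exists m, es, e.
have Vg : cs_val (V (cs_elt Dg)) = gen_ran S HK m es e by exact: VP.
have eg : U0 (gen_dom S HK m es e, 0) = (gen_ran S HK m es e, 0).
  by rewrite -Vg -hV.
have ed : W ((gen_dom S HK m es e).1, 0) = \sum_k P k (right_factor c k m (es, e)).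
  exact: (W_kern (fun=> m)).
have er : W ((gen_ran S HK m es e).1, 0) =
    \sum_k P k (right_factor c k (m - evec k) (es, e)).
  exact: (W_kern (fun k => m - evec k)).
rewrite /f /g eg; pose y := opU c (W ((gen_dom S HK m es e).1, 0), (gen_dom S HK m es e).2).
rewrite -[LHS]/(uinv W y.1, y.2).
have -> : y = (W ((gen_ran S HK m es e).1, 0), (gen_ran S HK m es e).2).
  by rewrite /y ed er; exact: colligation_step.
by rewrite uniK.
Qed.

Lemma realization_extends : exists (Ht : 'I_d -> hilbertType R) (U : extension HK Ht),
  extends_V V U /\ unitarily_equivalent c (dsum2_colligation U).
Proof.
exists Ht, U; split; first exact: U_extends.
exists (uinv W); split=> [k x|x e].
  apply: (@uni_inj _ _ _ W); rewrite uinvK /=.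
  have [p <-] := uni_surj W x; rewrite uniK Theta_proj /= /Theta.
  rewrite (bigD1 k) //= /dsum_proj eqxx big1 ?addr0 // => j /negPf kj.
  by rewrite kj cs_val0 addr0; have [Gl _ _ _ _] := GP j; rewrite (lin0 Gl).
transitivity (uinv W (opU c (W (uinv W x), e)).1, (opU c (W (uinv W x), e)).2) => //.
by rewrite uinvK.
Qed.

End Realization.

Theorem theorem7p1 (R : realType) (d : nat) (d_gt0 : (0 < d)%N)
    (E Es : hilbertType R)
    (S : multiindex d -> E -> Es) (S_SA : schur_agler S)
    (K : 'I_d -> kernel d (Es * E)%type) (K_dec : augmented_agler S K)
    (HK : forall k, rkhs (K k))
    (HK' : forall k, rkhs (shift_kernel k (K k)))
    (V : unitary (Vdom S HK) (Vran S HK)) (VP : is_V V)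
    (U0 : unitary (dsum HK * E * overlapping HK')%type
                  (dsum HK * Es * overlapping HK)%type)
    (U0P : is_U0 V U0) :
  [/\
    (* (1) *)
    forall c : colligation d E Es, realizes c S -> compatible c K ->
      exists (Ht : 'I_d -> hilbertType R) (U : extension HK Ht),
        extends_V V U /\ unitarily_equivalent c (dsum2_colligation U),
    (* (2) *)
    forall Ht : 'I_d -> hilbertType R,
      [/\ forall Ut : load HK HK' Ht,
            exists! U : extension HK Ht,
              extends_V V U /\ feedback U0 Ut U,
          forall U : extension HK Ht, extends_V V U ->
            exists! Ut : load HK HK' Ht, feedback U0 Ut U
        & forall (Ut : load HK HK' Ht) (U : extension HK Ht),
            feedback U0 Ut U -> forall x, U x = feedback_matrix U0 Ut x],
    (* (3) *)
    forall (Ht : 'I_d -> hilbertType R) (Ut : load HK HK' Ht)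
           (U : extension HK Ht),
      extends_V V U -> feedback U0 Ut U ->
      (closely_connected (dsum_colligation Ut) <->
       ~ exists M : closed_subspace (state (dsum2_colligation U)),
           [/\ exists x, M x /\ x <> 0,
               reducing M,
               forall x, M x -> x.1 = 0
             & forall k x, M x -> M (proj (dsum2_colligation U) k x)])
  & (* (4) *)
    forall (Ht Ht' : 'I_d -> hilbertType R)
           (Ut : load HK HK' Ht) (Ut' : load HK HK' Ht')
           (U : extension HK Ht) (U' : extension HK Ht'),
      extends_V V U -> feedback U0 Ut U ->
      extends_V V U' -> feedback U0 Ut' U' ->
      (unitarily_equivalent (dsum_colligation Ut) (dsum_colligation Ut') <->
       exists tau : unitary (state (dsum2_colligation U))
                            (state (dsum2_colligation U')),
         intertwines tau /\ forall f : dsum HK, tau (f, 0) = (f, 0))].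
Proof.
have loop_fb Ht (Ut : load HK HK' Ht) : feedback U0 Ut (closed_loop_unitary K_dec U0P Ut).
  exact/(feedbackP K_dec U0P).
split.
- by move=> c cS cK; exact: (realization_extends VP U0P cS cK).
- move=> Ht; split=> [Ut|U UV|Ut U /(feedbackP K_dec U0P) UE x].
  + exists (closed_loop_unitary K_dec U0P Ut); split.
      by split=> //; have /(extends_feedback K_dec U0P)[] := loop_fb _ Ut.
    by move=> U [_ /(feedbackP K_dec U0P) UE]; apply: uni_ext => x; rewrite UE.
  + have [Ut fb] := extension_load K_dec U0P UV; exists Ut; split=> // Ut'.
    exact: (feedback_load_uniq K_dec U0P fb).
  + by rewrite UE closed_loop_matrix.
- move=> Ht Ut U _ fb; split=> [cc [M [[x [Mx x0]] red M1 MP]]|].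
    exact: x0 (connected_no_reducing K_dec U0P fb cc red M1 MP Mx).
  by move=> noM M; exact: (no_reducing_connected K_dec U0P fb noM).
- move=> Ht Ht' Ut Ut' U U' _ fb _ fb'; split=> [|[tau [tI t0]]].
    exact: (equivalent_loads K_dec U0P fb fb').
  exact: (equivalent_extensions K_dec U0P fb fb' tI t0).
Qed.
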